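(* There exist absolute constants $c>0$ and $C>0$ such that the following holds. Let $p$ be a prime, let $n\geq 3$ be an integer, let $V$ be an $n$-dimensional vector space over the field $\mathbb{F}_p$, let $G=SL(V)$, and let $X\subseteq G$ be a generating set of $G$ which contains a transvection. Then the diameter of the Cayley graph $\operatorname{Cay}(G,X)$ is at most $C\,(\log p)^{c}\, n^{14}$.
   Context: A transvection in $SL(V)$ is an element $t$ of the form $t(x)=x+\phi(x)d$ for all $x\in V$, where $0\neq d\in V$, $0\neq\phi\in V^*=\operatorname{Hom}(V,\mathbb{F}_p)$ and $\phi(d)=0$. For a group $G$ and a generating set $X$, the (undirected) Cayley graph $\operatorname{Cay}(G,X)$ has vertex set $G$ and edges $\{g,gx\}$ for $g\in G$, $x\in X$; its diameter is the smallest $k$ such that every element of $G$ is a product of at most $k$ elements of $X\cup X^{-1}$. *)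

(* Defs.v *)
From mathcomp Require Import all_boot all_algebra all_field.
Set Implicit Arguments. Unset Strict Implicit. Unset Printing Implicit Defensive.
Import GRing.Theory.
Local Open Scope ring_scope.

Section SLdefs.
Variables (F : finFieldType) (n : nat).

(* V = 'rV[F]_n (row vectors); a matrix A acts by x |-> x *m A. *)
Definition SL : {set 'M[F]_n} := [set A : 'M[F]_n | \det A == 1].

(* t(x) = x + phi(x) d, with phi(x) = x *m f (f a nonzero column vector),
   d a nonzero row vector, phi(d) = d *m f = 0. *)
Definition is_transvection (t : 'M[F]_n) : Prop :=
  exists (d : 'rV[F]_n) (f : 'cV[F]_n),
    [/\ d != 0, f != 0, d *m f = 0 & t = 1%:M + f *m d].

Definition word_prod (s : seq 'M[F]_n) : 'M[F]_n :=
  foldr (fun a b => a *m b) 1%:M s.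

Definition symset (X : {set 'M[F]_n}) : {set 'M[F]_n} :=
  [set A | (A \in X) || (invmx A \in X)].

Definition generates_SL (X : {set 'M[F]_n}) : Prop :=
  X \subset SL /\
  forall g, g \in SL -> exists s : seq 'M[F]_n,
      all (fun a => a \in symset X) s /\ g = word_prod s.

Definition words_cover (X : {set 'M[F]_n}) (k : nat) : Prop :=
  forall g, g \in SL -> exists s : seq 'M[F]_n,
      [/\ (size s <= k)%N, all (fun a => a \in symset X) s & g = word_prod s].
End SLdefs.

(* Main.v *)
(* Let [t = 1 + f d] be the given transvection.

   Reduction to [SL_2].  In a representation of dimension [D], a linear condition
   that holds for some image [g u] of a vector [u] under [SL_n] already holds for
   [w u] with a word [w] of length at most [D].  So a short conjugate [1 + g e]
   of [t] has [d g <> 0 <> e f], and both act on the plane of [f] and [g] as two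
   opposite unipotents of [SL_2(p)]; every [1 + x f d] is then short once the
   diameter of [SL_2(p)] for two such generators is polylogarithmic in [p].

   Growth in [SL_2(p)].  Let [N(r)] be the size of the ball of radius [r].  A set
   [P] of elements of a fixed regular trace in that ball satisfies
   [|P|^3 <= C N(O(r))^2], because [(a1, a2, a3) |-> (a1 a2, a1 a3)] is generically
   two-to-one on it.  By orbit-stabiliser, a torus meeting the ball in a
   regular element meets it in at least [N(r) / N(O(r))^(2/3)] elements, and this
   property passes to all [p^2] conjugate tori.  Hence [N(14 r)] is much larger
   than [N(r)] until [N(r) > 2 p^(5/2)], and then a sumset [S + c S] of the set
   [S] of unipotents in a ball already fills more than half of the field.

   From root groups to [SL_n].  Since [SL_n] preserves no symplectic form up to
   scalars ([n >= 3]), a short conjugate of the root group of [t], moved by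
   [SL_2], has a commutator with [t] of the form [1 + f q] with [q] not
   proportional to [d].  For every short word [w] the pencil of [d] and [q]
   contains a functional [r] with [r w^-1 f = 0], and the commutator with the
   conjugate root [(w f, r w^-1)] is [1 + f r w^-1] up to a scalar; such
   functionals span the annihilator of [f].  Conjugating to a basis of vectors
   [w f] gives all elementary matrices, and Gaussian elimination finishes. *)

Require Import Defs.
From mathcomp Require Import all_boot all_algebra all_field.
From mathcomp Require Import ring zify.
Set Implicit Arguments. Unset Strict Implicit. Unset Printing Implicit Defensive.
Import GRing.Theory.
Local Open Scope ring_scope.

(** * Two by two matrices *)

Lemma card_le_fibers (T U : finType) (A : {set T}) (B : {set U}) (f : T -> U)
    (k : nat) :
  {in A, forall x, f x \in B} ->
  {in B, forall u, #|[set x in A | f x == u]| <= k}%N ->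
  (#|A| <= #|B| * k)%N.
Proof.
move=> fAB fib; rewrite -sum1_card (partition_big f (mem B)) //=.
rewrite -sum_nat_const; apply: leq_sum => u uB.
by rewrite sum1dep_card fib.
Qed.

Lemma card_le_two (T : finType) (A : {set T}) :
  {in A & A & A, forall x y z, x != y -> x != z -> y = z} -> (#|A| <= 2)%N.
Proof.
move=> AP; case: (set_0Vmem A) => [->|[x xA]]; first by rewrite cards0.
rewrite (cardsD1 x) xA add1n ltnS.
apply/card_le1_eqP => y z; rewrite !inE => /andP[yx yA] /andP[zx zA].
by apply/esym; apply: (AP x); rewrite // eq_sym.
Qed.

Section TwoByTwo.
Variable F : finFieldType.
Implicit Types (a b c d s t : F).

(** Quadruples of entries, so that matrix identities become polynomial identities for [ring]. *)
Definition mat2 : finType := (F * F * F * F)%type.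
Implicit Types (u v w g h : mat2).

Definition e11 u : F := u.1.1.1.
Definition e12 u : F := u.1.1.2.
Definition e21 u : F := u.1.2.
Definition e22 u : F := u.2.

Definition mul2 u v : mat2 :=
  (e11 u * e11 v + e12 u * e21 v, e11 u * e12 v + e12 u * e22 v,
   e21 u * e11 v + e22 u * e21 v, e21 u * e12 v + e22 u * e22 v).
(** The adjugate plays the role of the inverse: it is polynomial in the entries and agrees with the
    inverse in determinant 1. *)
Definition adj2 u : mat2 := (e22 u, - e12 u, - e21 u, e11 u).
Definition one2 : mat2 := (1, 0, 0, 1).
Definition det2 u := e11 u * e22 u - e12 u * e21 u.
Definition tr2 u := e11 u + e22 u.
Definition upper t : mat2 := (1, t, 0, 1).
Definition lower t : mat2 := (1, 0, t, 1).
Definition conj2 g u := mul2 (mul2 g u) (adj2 g).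

Lemma mul2A : associative mul2.
Proof.
move=> [[[a b] c] d] [[[a1 b1] c1] d1] [[[a2 b2] c2] d2].
by rewrite /mul2 /e11 /e12 /e21 /e22 /=; congr (_, _, _, _); ring.
Qed.

Lemma mul21 u : mul2 u one2 = u.
Proof. by case: u => [[[a b] c] d]; rewrite /mul2 /e11 /e12 /e21 /e22 /=; congr (_, _, _, _); ring. Qed.

Lemma mul12 u : mul2 one2 u = u.
Proof. by case: u => [[[a b] c] d]; rewrite /mul2 /e11 /e12 /e21 /e22 /=; congr (_, _, _, _); ring. Qed.

Lemma det2M u v : det2 (mul2 u v) = det2 u * det2 v.
Proof.
by move: u v => [[[a b] c] d] [[[a1 b1] c1] d1]; rewrite /det2 /mul2 /e11 /e12 /e21 /e22 /=; ring.
Qed.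

Lemma adj2M u v : adj2 (mul2 u v) = mul2 (adj2 v) (adj2 u).
Proof.
move: u v => [[[a b] c] d] [[[a1 b1] c1] d1].
by rewrite /adj2 /mul2 /e11 /e12 /e21 /e22 /=; congr (_, _, _, _); ring.
Qed.

Lemma det2_adj u : det2 (adj2 u) = det2 u.
Proof. by case: u => [[[a b] c] d]; rewrite /det2 /adj2 /e11 /e12 /e21 /e22 /=; ring. Qed.

Lemma adj2K : involutive adj2.
Proof. by case=> [[[a b] c] d]; rewrite /adj2 /e11 /e12 /e21 /e22 /= !opprK. Qed.

Lemma mul2V u : det2 u = 1 -> mul2 u (adj2 u) = one2.
Proof.
case: u => [[[a b] c] d]; rewrite /det2 /mul2 /adj2 /one2 /e11 /e12 /e21 /e22 /= => E.
by rewrite -{1 2}E; congr (_, _, _, _); ring.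
Qed.

Lemma mulV2 u : det2 u = 1 -> mul2 (adj2 u) u = one2.
Proof. by move=> E; rewrite -{2}[u]adj2K mul2V ?det2_adj. Qed.

Lemma mul2I g : det2 g = 1 -> injective (mul2 g).
Proof. by move=> dg u v E; rewrite -[u]mul12 -(mulV2 dg) -mul2A E mul2A mulV2 ?mul12. Qed.

Lemma mulI2 g : det2 g = 1 -> injective (mul2^~ g).
Proof. by move=> dg u v E; rewrite -[u]mul21 -(mul2V dg) mul2A E -mul2A mul2V ?mul21. Qed.

Lemma det2_conj g u : det2 g = 1 -> det2 (conj2 g u) = det2 u.
Proof. by move=> dg; rewrite /conj2 !det2M det2_adj dg mul1r mulr1. Qed.

Lemma tr2_conj g u : det2 g = 1 -> tr2 (conj2 g u) = tr2 u.
Proof.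
move: u g => [[[a b] c] d] [[[a1 b1] c1] d1].
rewrite /tr2 /conj2 /mul2 /adj2 /det2 /e11 /e12 /e21 /e22 /= => E.
transitivity ((a1 * d1 - b1 * c1) * (a + d)); first by ring.
by rewrite E mul1r.
Qed.

Lemma conj2_inj g : det2 g = 1 -> injective (conj2 g).
Proof. by move=> dg u v /mulI2 E; apply: (mul2I dg); apply: E; rewrite det2_adj. Qed.

Lemma conj2M g h u : conj2 (mul2 g h) u = conj2 g (conj2 h u).
Proof. by rewrite /conj2 adj2M !mul2A. Qed.

Lemma adj_one : adj2 one2 = one2.
Proof. by rewrite /adj2 /one2 /e11 /e12 /e21 /e22 /= oppr0. Qed.

Lemma conj21 u : conj2 one2 u = u.
Proof. by rewrite /conj2 adj_one mul12 mul21. Qed.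

Lemma det2_up t : det2 (upper t) = 1.
Proof. by rewrite /det2 /upper /e11 /e12 /e21 /e22 /=; ring. Qed.
Lemma det2_low t : det2 (lower t) = 1.
Proof. by rewrite /det2 /lower /e11 /e12 /e21 /e22 /=; ring. Qed.
Lemma det2_one : det2 one2 = 1.
Proof. by rewrite /det2 /one2 /e11 /e12 /e21 /e22 /=; ring. Qed.

Lemma upD s t : mul2 (upper s) (upper t) = upper (s + t).
Proof. by rewrite /mul2 /upper /e11 /e12 /e21 /e22 /=; congr (_, _, _, _); ring. Qed.
Lemma lowD s t : mul2 (lower s) (lower t) = lower (s + t).
Proof. by rewrite /mul2 /lower /e11 /e12 /e21 /e22 /=; congr (_, _, _, _); ring. Qed.
Lemma up0 : upper 0 = one2. Proof. by []. Qed.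
Lemma low0 : lower 0 = one2. Proof. by []. Qed.
Lemma adj_up t : adj2 (upper t) = upper (- t).
Proof. by rewrite /adj2 /upper /e11 /e12 /e21 /e22 /= oppr0. Qed.
Lemma adj_low t : adj2 (lower t) = lower (- t).
Proof. by rewrite /adj2 /lower /e11 /e12 /e21 /e22 /= oppr0. Qed.

(* The discriminant of the Lie bracket of [u] and [v]; for [u], [v] of
   determinant 1 it vanishes iff they have a common eigenvector. *)
Definition brk1 u v := e12 u * e21 v - e21 u * e12 v.
Definition brk2 u v := e12 v * (e11 u - e22 u) - e12 u * (e11 v - e22 v).
Definition brk3 u v := e21 u * (e11 v - e22 v) - e21 v * (e11 u - e22 u).
Definition bracket_disc u v := brk1 u v ^+ 2 + brk2 u v * brk3 u v.

(* The conditions say that [a] lies on the affine line orthogonal to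
   [1, g, h], and the norm form restricted to that line is a quadratic
   polynomial with leading coefficient [- bracket_disc g h]. *)
Lemma two_solutions (tau : F) (g h a1 a2 a3 : mat2) :
  bracket_disc g h != 0 ->
  (forall a : mat2, a \in [:: a1; a2; a3] ->
     [/\ det2 a = 1, tr2 a = tau, tr2 (mul2 (adj2 a) g) = tau &
         tr2 (mul2 (adj2 a) h) = tau]) ->
  a1 != a2 -> a1 != a3 -> a2 = a3.
Proof.
move=> D0 H.
have [] := H a1; first by rewrite !inE eqxx.
have [] := H a2; first by rewrite !inE eqxx orbT.
have [] := H a3; first by rewrite !inE eqxx !orbT.
move: D0 {H}; move: g h a1 a2 a3 => [[[g1 g2] g3] g4] [[[h1 h2] h3] h4]
 [[[x1 x2] x3] x4] [[[y1 y2] y3] y4] [[[z1 z2] z3] z4].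
rewrite /tr2 /mul2 /adj2 /det2 /bracket_disc /brk1 /brk2 /brk3 /e11 /e12 /e21 /e22 /=.
set p1 := g2 * h3 - g3 * h2; set p2 := h2 * (g1 - g4) - g2 * (h1 - h4).
set p3 := g3 * (h1 - h4) - h3 * (g1 - g4).
(* Up to sign, [(p1, p2, p3)] is the cross product of the coordinate vectors of [g] and [h] modulo
   scalars. It is nonzero by the discriminant, so every vector orthogonal to both is a multiple of
   it. *)
have line (v1 v2 v3 : F) : p1 ^+ 2 + p2 * p3 != 0 ->
   v1 * (g1 - g4) + v2 * g3 + v3 * g2 = 0 ->
   v1 * (h1 - h4) + v2 * h3 + v3 * h2 = 0 ->
   exists s, [/\ v1 = s * p1, v2 = s * p2 & v3 = s * p3].
  move=> D0 Eg Eh.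
  have E12 : v1 * p2 = v2 * p1.
    apply/eqP; rewrite -subr_eq0; apply/eqP.
    transitivity (h2 * (v1 * (g1 - g4) + v2 * g3 + v3 * g2)
                  - g2 * (v1 * (h1 - h4) + v2 * h3 + v3 * h2)); first by rewrite /p1 /p2; ring.
    by rewrite Eg Eh; ring.
  have E13 : v1 * p3 = v3 * p1.
    apply/eqP; rewrite -subr_eq0; apply/eqP.
    transitivity (g3 * (v1 * (h1 - h4) + v2 * h3 + v3 * h2)
                  - h3 * (v1 * (g1 - g4) + v2 * g3 + v3 * g2)); first by rewrite /p1 /p3; ring.
    by rewrite Eg Eh; ring.
  have E23 : v2 * p3 = v3 * p2.
    apply/eqP; rewrite -subr_eq0; apply/eqP.
    transitivity ((h1 - h4) * (v1 * (g1 - g4) + v2 * g3 + v3 * g2)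
                  - (g1 - g4) * (v1 * (h1 - h4) + v2 * h3 + v3 * h2)); first by rewrite /p2 /p3; ring.
    by rewrite Eg Eh; ring.
  have [p10|p10] := eqVneq p1 0.
    have p20 : p2 != 0.
      by apply: contraNneq D0 => ->; rewrite p10 mul0r expr0n addr0.
    exists (v2 / p2); split; first by apply: (mulIf p20); rewrite E12 p10; ring.
      by rewrite divfK.
    by rewrite mulrAC E23 mulfK.
  exists (v1 / p1); split; first by rewrite divfK.
    by rewrite mulrAC E12 mulfK.
  by rewrite mulrAC E13 mulfK.
move=> D0 dz tz gz hz dy ty gy hy dx tx gx hx nxy nxz.
have x4E : x4 = tau - x1 by rewrite -tx; ring.
have y4E : y4 = tau - y1 by rewrite -ty; ring.
have z4E : z4 = tau - z1 by rewrite -tz; ring.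
have [s [s1 s2 s3]] : exists s, [/\ y1 - x1 = s * p1, y2 - x2 = s * p2 & y3 - x3 = s * p3].
  apply: line => //.
    transitivity ((x4 * g1 + - x2 * g3 + (- x3 * g2 + x1 * g4)) - (y4 * g1 + - y2 * g3 + (- y3 * g2 + y1 * g4))).
      by rewrite x4E y4E; ring.
    by rewrite gx gy subrr.
  transitivity ((x4 * h1 + - x2 * h3 + (- x3 * h2 + x1 * h4)) - (y4 * h1 + - y2 * h3 + (- y3 * h2 + y1 * h4))).
    by rewrite x4E y4E; ring.
  by rewrite hx hy subrr.
have [t [t1 t2 t3]] : exists s, [/\ z1 - x1 = s * p1, z2 - x2 = s * p2 & z3 - x3 = s * p3].
  apply: line => //.
    transitivity ((x4 * g1 + - x2 * g3 + (- x3 * g2 + x1 * g4)) - (z4 * g1 + - z2 * g3 + (- z3 * g2 + z1 * g4))).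
      by rewrite x4E z4E; ring.
    by rewrite gx gz subrr.
  transitivity ((x4 * h1 + - x2 * h3 + (- x3 * h2 + x1 * h4)) - (z4 * h1 + - z2 * h3 + (- z3 * h2 + z1 * h4))).
    by rewrite x4E z4E; ring.
  by rewrite hx hz subrr.
move: D0; set D := p1 ^+ 2 + p2 * p3 => D0.
pose L := (tau - 2 * x1) * p1 - x2 * p3 - x3 * p2.
(* Along the line through [x] the determinant changes by [r * (L - r * D)], so besides [r = 0] there
   is a single root. *)
have root (r w1 w2 w3 w4 : F) : w1 - x1 = r * p1 -> w2 - x2 = r * p2 -> w3 - x3 = r * p3 ->
    w4 = tau - w1 -> w1 * w4 - w2 * w3 = 1 -> r != 0 -> r = L / D.
  move=> E1 E2 E3 E4 Ed r0.
  have : r * (L - r * D) = 0.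
    transitivity ((w1 * w4 - w2 * w3) - (x1 * x4 - x2 * x3)); last by rewrite Ed dx subrr.
    have -> : w1 = x1 + r * p1 by rewrite -E1; ring.
    have -> : w2 = x2 + r * p2 by rewrite -E2; ring.
    have -> : w3 = x3 + r * p3 by rewrite -E3; ring.
    have -> : w4 = tau - (x1 + r * p1) by rewrite E4 -E1; ring.
    by rewrite x4E /L /D; ring.
  move/eqP; rewrite mulf_eq0 (negPf r0) /= subr_eq0 => /eqP ->.
  by rewrite mulfK.
have nz (r w1 w2 w3 w4 : F) : w1 - x1 = r * p1 -> w2 - x2 = r * p2 -> w3 - x3 = r * p3 ->
    w4 = tau - w1 -> (x1, x2, x3, x4) != (w1, w2, w3, w4) -> r != 0.
  move=> E1 E2 E3 E4; apply: contraNneq => r0; move: E1 E2 E3.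
  rewrite r0 !mul0r => /eqP; rewrite subr_eq0 => /eqP E1 /eqP; rewrite subr_eq0 => /eqP E2.
  by move=> /eqP; rewrite subr_eq0 => /eqP E3; rewrite E4 x4E E1 E2 E3.
have st : s = t.
  have -> : s = L / D.
    by apply: (root _ _ _ _ _ s1 s2 s3 y4E dy); apply: (nz _ _ _ _ _ s1 s2 s3 y4E nxy).
  by apply/esym; apply: (root _ _ _ _ _ t1 t2 t3 z4E dz); apply: (nz _ _ _ _ _ t1 t2 t3 z4E nxz).
have <- : y1 = z1 by apply: (addIr (- x1)); rewrite s1 t1 st.
have <- : y2 = z2 by apply: (addIr (- x2)); rewrite s2 t2 st.
have <- : y3 = z3 by apply: (addIr (- x3)); rewrite s3 t3 st.
suff <- : y4 = z4 by [].
by rewrite y4E z4E; congr (_ - _); apply: (addIr (- x1)); rewrite s1 t1 st.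
Qed.

End TwoByTwo.
Arguments one2 {F}.

(** The fourth difference with step b of a quartic is 4! b^4 times its leading coefficient; this is
    the origin of the condition [24 != 0]. *)
Lemma fourth_difference (R : comNzRingType) (b x0 x1 x2 y0 y1 y2 z0 z1 z2 : R) :
  let f t := (x0 + t * x1 + t ^+ 2 * x2) ^+ 2 +
             (y0 + t * y1 + t ^+ 2 * y2) * (z0 + t * z1 + t ^+ 2 * z2) in
  24 * b ^+ 4 * (x2 ^+ 2 + y2 * z2) =
  f (0%:R * b) - 4 * f (1%:R * b) + 6 * f (2%:R * b) - 4 * f (3%:R * b) + f (4%:R * b).
Proof. by move=> f; rewrite /f; ring. Qed.

(** * Conjugation into general position *)

Section Escape.
Variable F : finFieldType.
Implicit Types (b c t : F) (u v w : mat2 F).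

(** In determinant 1 this says that the characteristic polynomial has nonzero discriminant. *)
Definition regular u := tr2 u ^+ 2 != 4.

(* In the escape lemmas, the entry in question is a polynomial of degree [m] in
   the parameter; if it vanished at [m + 1] points in arithmetic progression, so
   would its [m]-th difference, i.e. its leading coefficient. *)
Lemma escape_low c u : c != 0 -> 2 != 0 :> F -> det2 u = 1 -> regular u ->
  exists i : 'I_3, e21 (conj2 (lower (i%:R * c)) u) != 0.
Proof.
move=> c0 n2 du ru; apply/existsP; apply: contraNT ru => /existsPn H.
have z i : e21 (conj2 (lower ((i : 'I_3)%:R * c)) u) = 0.
  by apply/eqP; have := H i; rewrite negbK.
move: (z (@Ordinal 3 0 isT)) (z (@Ordinal 3 1 isT)) (z (@Ordinal 3 2 isT)) => {z H} /=.
case: u du => [[[x1 x2] x3] x4].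
rewrite /regular /det2 /tr2 /conj2 /mul2 /adj2 /lower /e11 /e12 /e21 /e22 /= => du z0 z1 z2.
have x30 : x3 = 0 by rewrite -z0; ring.
have x20 : x2 = 0.
  have : - (2 * c ^+ 2) * x2 = 0.
    by transitivity (0 - 2 * 0 + 0 : F); [rewrite -{1}z0 -{1}z1 -z2; ring|ring].
  have n0 : - (2 * c ^+ 2) != 0 by rewrite oppr_eq0 mulf_neq0 ?expf_neq0.
  by move/eqP; rewrite mulf_eq0 (negPf n0) => /eqP.
have : c * (x1 - x4) = 0 by rewrite -z1 x20 x30; ring.
move/eqP; rewrite mulf_eq0 (negPf c0) subr_eq0 /= => /eqP x14.
apply/eqP; transitivity (4 * (x1 * x4 - x2 * x3)); first by rewrite x20 x14; ring.
by rewrite du mulr1.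
Qed.

Lemma escape_up2 b u v : b != 0 -> 2 != 0 :> F -> e21 u != 0 -> e21 v != 0 ->
  exists j : 'I_3,
    (e21 (mul2 u (conj2 (upper (j%:R * b)) v)) != 0) &&
    (e21 (mul2 (conj2 (upper (j%:R * b)) v) u) != 0).
Proof.
move=> b0 n2 u0 v0; apply/existsP; have : 2 * b ^+ 2 * (e21 u * e21 v) ^+ 2 != 0.
  by rewrite !mulf_neq0 ?expf_neq0 ?mulf_neq0.
apply: contraNT => /existsPn H.
(* Both entries are linear in the parameter, with leading coefficients [e21 u * e21 v] up to sign;
   their product is a quadratic that handles both at once. *)
pose f (j : 'I_3) := e21 (mul2 u (conj2 (upper (j%:R * b)) v)) *
                     e21 (mul2 (conj2 (upper (j%:R * b)) v) u).
have z j : f j = 0 by apply/eqP; have := H j; rewrite /f mulf_eq0 -negb_or negbK.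
apply/eqP.
transitivity (- (f (@Ordinal 3 0 isT) - 2 * f (@Ordinal 3 1 isT) + f (@Ordinal 3 2 isT))).
  rewrite /f /=; move: u v {u0 v0 H f z} => [[[x1 x2] x3] x4] [[[y1 y2] y3] y4].
  by rewrite /conj2 /mul2 /adj2 /upper /e11 /e12 /e21 /e22 /=; ring.
by rewrite !z; ring.
Qed.

Lemma conj2_up t w : conj2 (upper t) w =
  (e11 w + t * e21 w, e12 w + t * (e22 w - e11 w) - t ^+ 2 * e21 w,
   e21 w, e22 w - t * e21 w).
Proof.
case: w => [[[z1 z2] z3] z4].
by rewrite /conj2 /mul2 /adj2 /upper /e11 /e12 /e21 /e22 /=; congr (_, _, _, _); ring.
Qed.

Lemma escape_up3 b u v w : b != 0 -> 24 != 0 :> F -> det2 u = 1 ->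
  e21 (mul2 u v) != 0 -> e21 (mul2 v u) != 0 -> e21 w != 0 ->
  exists k : 'I_5,
    bracket_disc (mul2 u v) (mul2 u (conj2 (upper (k%:R * b)) w)) != 0.
Proof.
move=> b0 n24 du uv vu w0; apply/existsP.
have : 24 * b ^+ 4 * e21 w ^+ 2 * (det2 u * e21 (mul2 u v) * e21 (mul2 v u)) != 0.
  by rewrite !mulf_neq0 ?expf_neq0 // du oner_eq0.
apply: contraNT => /existsPn H.
pose f (k : 'I_5) := bracket_disc (mul2 u v) (mul2 u (conj2 (upper (k%:R * b)) w)).
have z k : f k = 0 by apply/eqP; have := H k; rewrite negbK.
apply/eqP.
transitivity (f (@Ordinal 5 0 isT) - 4 * f (@Ordinal 5 1 isT) + 6 * f (@Ordinal 5 2 isT)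
   - 4 * f (@Ordinal 5 3 isT) + f (@Ordinal 5 4 isT)).
  (* The conjugate is w + t w1 + t^2 w2, so each [brk] becomes a quadratic in t and the discriminant
     a quartic, whose leading coefficient is [lead]. *)
  pose w1 : mat2 F := (e21 w, e22 w - e11 w, 0, - e21 w).
  pose w2 : mat2 F := (0, - e21 w, 0, 0).
  pose g := mul2 u v.
  have quad (B : mat2 F -> mat2 F -> F) t :
      (forall x y h, B g (e11 h + e11 x * t + e11 y * t ^+ 2, e12 h + e12 x * t + e12 y * t ^+ 2,
        e21 h + e21 x * t + e21 y * t ^+ 2, e22 h + e22 x * t + e22 y * t ^+ 2)
        = B g h + t * B g x + t ^+ 2 * B g y) ->
      B g (mul2 u (conj2 (upper t) w))
      = B g (mul2 u w) + t * B g (mul2 u w1) + t ^+ 2 * B g (mul2 u w2).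
    move=> <-; congr (B g _); rewrite conj2_up /w1 /w2 /mul2 /e11 /e12 /e21 /e22 /=.
    by congr (_, _, _, _); ring.
  have fE t : bracket_disc g (mul2 u (conj2 (upper t) w)) =
      (brk1 g (mul2 u w) + t * brk1 g (mul2 u w1) + t ^+ 2 * brk1 g (mul2 u w2)) ^+ 2
      + (brk2 g (mul2 u w) + t * brk2 g (mul2 u w1) + t ^+ 2 * brk2 g (mul2 u w2))
      * (brk3 g (mul2 u w) + t * brk3 g (mul2 u w1) + t ^+ 2 * brk3 g (mul2 u w2)).
    rewrite /bracket_disc !quad // => x y h;
    by rewrite /brk1 /brk2 /brk3 /e11 /e12 /e21 /e22 /=; ring.
  have lead : e21 w ^+ 2 * (det2 u * e21 (mul2 u v) * e21 (mul2 v u))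
      = brk1 g (mul2 u w2) ^+ 2 + brk2 g (mul2 u w2) * brk3 g (mul2 u w2).
    rewrite /g /w2; move: (e21 w) => y.
    move: u v {du uv vu f z fE quad g H} => [[[x1 x2] x3] x4] [[[y1 y2] y3] y4].
    by rewrite /brk1 /brk2 /brk3 /det2 /mul2 /e11 /e12 /e21 /e22 /=; ring.
  rewrite -mulrA lead /f -/g !fE.
  exact: (fourth_difference b (brk1 g (mul2 u w)) (brk1 g (mul2 u w1)) _
    (brk2 g (mul2 u w)) (brk2 g (mul2 u w1)) _ (brk3 g (mul2 u w)) (brk3 g (mul2 u w1))).
by rewrite !z; ring.
Qed.

(** Under conjugation the lower factor acts first and makes the lower left entry nonzero; the upper
    factor keeps that entry and supplies the parameter for general position. *)
Definition twist (b c : F) (j i : nat) : mat2 F :=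
  mul2 (upper (j%:R * b)) (lower (i%:R * c)).

Lemma det2_twist b c j i : det2 (twist b c j i) = 1.
Proof. by rewrite det2M det2_up det2_low mulr1. Qed.

Lemma escape b c u v w : b != 0 -> c != 0 -> 24 != 0 :> F ->
  det2 u = 1 -> det2 v = 1 -> det2 w = 1 -> regular u -> regular v -> regular w ->
  exists i : 'I_3 * 'I_3 * 'I_3 * 'I_3 * 'I_5,
    let u' := conj2 (twist b c 0 i.1.1.1.1) u in
    bracket_disc (mul2 u' (conj2 (twist b c i.1.1.1.2 i.1.1.2) v))
                 (mul2 u' (conj2 (twist b c i.2 i.1.2) w)) != 0.
Proof.
move=> b0 c0 n24 du dv dw ru rv rw.
have n2 : 2 != 0 :> F.
  apply: contraNneq n24 => n2; have -> : 24 = 2 * 12 :> F by ring.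
  by rewrite n2 mul0r.
have [i1 h1] := escape_low c0 n2 du ru.
have [i2 h2] := escape_low c0 n2 dv rv.
have [i3 h3] := escape_low c0 n2 dw rw.
have [j /andP[h4 h5]] := escape_up2 b0 n2 h1 h2.
have du' : det2 (conj2 (lower (i1%:R * c)) u) = 1 by rewrite det2_conj ?det2_low.
have [k hk] := escape_up3 b0 n24 du' h4 h5 h3.
exists (i1, j, i2, i3, k) => /=; rewrite /twist !conj2M.
by rewrite mul0r up0 conj21.
Qed.

End Escape.

(** * Growth of balls in SL_2 *)

Section Ball.
Variables (F : finFieldType) (b c : F).
Implicit Types (t : F) (u v w g h : mat2 F) (r s : nat).

(** The identity is included so that [ball r] consists of the words of length at most r. *)
Definition gens2 : {set mat2 F} := [set one2; upper b; upper (- b); lower c; lower (- c)].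

Fixpoint ball r : {set mat2 F} :=
  if r is r'.+1 then [set mul2 g h | g in gens2, h in ball r'] else [set one2].

Lemma ballS r u : reflect (exists2 g, g \in gens2 & exists2 h, h \in ball r & u = mul2 g h)
  (u \in ball r.+1).
Proof.
apply: (iffP imset2P) => [[g h gG hB ->]|[g gG [h hB ->]]]; first by exists g => //; exists h.
by exists g h.
Qed.

Lemma one_gens2 : one2 \in gens2. Proof. by rewrite !inE eqxx. Qed.

Lemma gens2P g : g \in gens2 -> [\/ g = one2, exists2 t, t = b \/ t = - b & g = upper t |
  exists2 t, t = c \/ t = - c & g = lower t].
Proof.
rewrite !inE -!orbA => /or4P[/eqP->|/eqP->|/eqP->|/orP[]/eqP->].
- by constructor 1.
- by constructor 2; exists b; auto.
- by constructor 2; exists (- b); auto.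
- by constructor 3; exists c; auto.
- by constructor 3; exists (- c); auto.
Qed.

Lemma adj_gens2 g : g \in gens2 -> adj2 g \in gens2.
Proof.
case/gens2P => [->|[t [->|->] ->]|[t [->|->] ->]]; first by rewrite adj_one one_gens2.
all: by rewrite ?adj_up ?adj_low ?opprK !inE eqxx ?orbT.
Qed.

Lemma gens2_det g : g \in gens2 -> det2 g = 1.
Proof. by case/gens2P => [->|[t _ ->]|[t _ ->]]; rewrite ?det2_one ?det2_up ?det2_low. Qed.

Lemma ball_det r u : u \in ball r -> det2 u = 1.
Proof.
elim: r u => [|r IH] u; first by rewrite inE => /eqP ->; rewrite det2_one.
by case/ballS => g gG [h /IH dh ->]; rewrite det2M (gens2_det gG) dh mulr1.
Qed.

Lemma one_ball r : one2 \in ball r.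
Proof.
elim: r => [|r IH]; first by rewrite inE.
by apply/ballS; exists (one2); rewrite ?one_gens2 //; exists (one2); rewrite ?mul21.
Qed.

Lemma ball_mul r s u v : u \in ball r -> v \in ball s -> mul2 u v \in ball (r + s).
Proof.
elim: r u => [|r IH] u; first by rewrite inE => /eqP -> vB; rewrite mul12.
case/ballS => g gG [h hB ->] vB; rewrite addSn; apply/ballS; exists g => //.
by exists (mul2 h v); rewrite ?IH ?mul2A.
Qed.

Lemma ball_gen g : g \in gens2 -> g \in ball 1.
Proof. by move=> gG; apply/ballS; exists g => //; exists (one2); rewrite ?mul21 ?inE. Qed.

Lemma ball_mono r s u : (r <= s)%N -> u \in ball r -> u \in ball s.
Proof. by move=> /subnK <- uB; rewrite -[u]mul12 ball_mul ?one_ball. Qed.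

Lemma ball_adj r u : u \in ball r -> adj2 u \in ball r.
Proof.
elim: r u => [|r IH] u.
  by rewrite !inE => /eqP ->; rewrite adj_one.
case/ballS => g gG [h hB ->]; rewrite adj2M -addn1 ball_mul ?IH //.
exact/ball_gen/adj_gens2.
Qed.

Lemma ball_conj r s g u : g \in ball r -> u \in ball s -> conj2 g u \in ball (r + s + r).
Proof. by move=> gB uB; rewrite /conj2 !ball_mul ?ball_adj. Qed.

Lemma ball_up j : upper (j%:R * b) \in ball j.
Proof.
elim: j => [|j IH]; first by rewrite mul0r up0 inE.
by rewrite -add1n natrD mulrDl mul1r -upD ball_mul ?ball_gen // !inE eqxx orbT.
Qed.

Lemma ball_low j : lower (j%:R * c) \in ball j.
Proof.
elim: j => [|j IH]; first by rewrite mul0r low0 inE.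
by rewrite -add1n natrD mulrDl mul1r -lowD ball_mul ?ball_gen // !inE eqxx !orbT.
Qed.

Lemma ball_twist j i : twist b c j i \in ball (j + i).
Proof. by rewrite ball_mul ?ball_up ?ball_low. Qed.

Hypotheses (b0 : b != 0) (c0 : c != 0) (n24 : 24 != 0 :> F).

(** Each triple from [P] is conjugated by short twists to a generic (a1, a2, a3) and sent to g = a1
    a2, h = a1 a3. Given g and h, the element a1 has trace tau, and so have a1^-1 g and a1^-1 h,
    being conjugates of elements of [P]; hence [two_solutions] leaves at most two choices for it,
    and it determines the rest. The value of [f] records the twist. *)
Lemma trace_class_bound r (tau : F) (P : {set mat2 F}) :
  tau ^+ 2 != 4 -> P \subset ball r -> {in P, forall u, tr2 u = tau} ->
  (#|P| ^ 3 <= 810 * #|ball (2 * r + 16)| ^ 2)%N.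
Proof.
move=> tau4 PB Ptr.
pose I : finType := ('I_3 * 'I_3 * 'I_3 * 'I_3 * 'I_5)%type.
pose k1 (i : I) := twist b c 0 i.1.1.1.1; pose k2 (i : I) := twist b c i.1.1.1.2 i.1.1.2.
pose k3 (i : I) := twist b c i.2 i.1.2.
pose G i (x : mat2 F * mat2 F * mat2 F) := mul2 (conj2 (k1 i) x.1.1) (conj2 (k2 i) x.1.2).
pose H i (x : mat2 F * mat2 F * mat2 F) := mul2 (conj2 (k1 i) x.1.1) (conj2 (k3 i) x.2).
(* By [piP] the default index is never taken on [A]. *)
pose pi x : I := odflt (ord0, ord0, ord0, ord0, ord0) [pick i | bracket_disc (G i x) (H i x) != 0].
pose A := setX (setX P P) P.
have Pdet u : u \in P -> det2 u = 1 by move=> /(subsetP PB)/ball_det.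
have Preg u : u \in P -> regular u by move=> /Ptr; rewrite /regular => ->.
have piP x : x \in A -> bracket_disc (G (pi x) x) (H (pi x) x) != 0.
  case: x => [[u v] w]; rewrite !inE /= => /andP[/andP[uP vP] wP]; rewrite /pi; case: pickP => //=.
  have [i hi] := escape b0 c0 n24 (Pdet _ uP) (Pdet _ vP) (Pdet _ wP) (Preg _ uP) (Preg _ vP) (Preg _ wP).
  by move=> /(_ i); rewrite /G /H /= hi.
pose f x := (pi x, G (pi x) x, H (pi x) x).
have dk1 i : det2 (k1 i) = 1 by rewrite det2_twist.
have dk2 i : det2 (k2 i) = 1 by rewrite det2_twist.
have dk3 i : det2 (k3 i) = 1 by rewrite det2_twist.
(* The three conjugators have length at most 2, 4 and 6, so the two products have length at most 2 r
   + 12 and 2 r + 16. *)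
have small (i : 'I_3) : (i <= 2)%N by rewrite -ltnS.
have B1 i u : u \in P -> conj2 (k1 i) u \in ball (r + 4).
  move=> /(subsetP PB) uB; apply: ball_mono (ball_conj (ball_twist _ _) uB).
  by have := small i.1.1.1.1; lia.
have B2 i u : u \in P -> conj2 (k2 i) u \in ball (r + 8).
  move=> /(subsetP PB) uB; apply: ball_mono (ball_conj (ball_twist _ _) uB).
  by have := small i.1.1.1.2; have := small i.1.1.2; lia.
have B3 i u : u \in P -> conj2 (k3 i) u \in ball (r + 12).
  move=> /(subsetP PB) uB; apply: ball_mono (ball_conj (ball_twist _ _) uB).
  by have := small i.1.2; have := ltn_ord i.2; lia.
have -> : (#|P| ^ 3 = #|A|)%N by rewrite !cardsX -mulnA.
pose N := ball (2 * r + 16).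
(* There are 3^4 * 5 = 405 indices and each fibre has at most two elements, whence 810. *)
apply: leq_trans (@card_le_fibers _ _ A (setX (setX setT N) N) f 2 _ _) _; last first.
- rewrite !cardsX cardsT !card_prod !card_ord.
  by rewrite /N; lia.
- move=> [[i g] h] _; apply: card_le_two => x y z; rewrite !inE.
  case: x y z => [[x1 x2] x3] [[y1 y2] y3] [[z1 z2] z3] /=.
  move=> /andP[xA /eqP fx] /andP[yA /eqP fy] /andP[zA /eqP fz] nxy nxz.
  have fact x : x \in A -> f x = (i, g, h) ->
    [/\ bracket_disc g h != 0, G i x = g & H i x = h].
    by move=> xA' fx'; have := piP _ xA'; move: fx'; rewrite /f => [[<- <- <-]].
  have inA u v w : [&& u \in P & v \in P] && (w \in P) -> (u, v, w) \in A by rewrite !inE.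
  have {fx} [gh Gx Hx] := fact (x1, x2, x3) (inA _ _ _ xA) fx.
  have {fy} [_ Gy Hy] := fact (y1, y2, y3) (inA _ _ _ yA) fy.
  have {fz} [_ Gz Hz] := fact (z1, z2, z3) (inA _ _ _ zA) fz.
  move: xA yA zA Gx Hx Gy Hy Gz Hz; rewrite /G /H /=.
  move=> /andP[/andP[x1P x2P] x3P] /andP[/andP[y1P y2P] y3P] /andP[/andP[z1P z2P] z3P].
  move=> Gx Hx Gy Hy Gz Hz.
  have recov (a b1 b2 d : mat2 F) k : det2 a = 1 -> det2 k = 1 ->
      mul2 a (conj2 k b1) = d -> mul2 a (conj2 k b2) = d -> b1 = b2.
    by move=> da dk <- /(mul2I da)/(conj2_inj dk).
  have key (a1 a2 a3 : mat2 F) : a1 \in P -> a2 \in P -> a3 \in P ->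
     mul2 (conj2 (k1 i) a1) (conj2 (k2 i) a2) = g ->
     mul2 (conj2 (k1 i) a1) (conj2 (k3 i) a3) = h ->
     [/\ det2 (conj2 (k1 i) a1) = 1, tr2 (conj2 (k1 i) a1) = tau,
       tr2 (mul2 (adj2 (conj2 (k1 i) a1)) g) = tau &
       tr2 (mul2 (adj2 (conj2 (k1 i) a1)) h) = tau].
    move=> a1P a2P a3P <- <-.
    have da : det2 (conj2 (k1 i) a1) = 1 by rewrite (det2_conj _ (dk1 i)) Pdet.
    have cancel d : mul2 (adj2 (conj2 (k1 i) a1)) (mul2 (conj2 (k1 i) a1) d) = d.
      by rewrite mul2A mulV2 // mul12.
    by rewrite !cancel (tr2_conj _ (dk1 i)) (tr2_conj _ (dk2 i)) (tr2_conj _ (dk3 i)) !Ptr.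
  have first_eq (x1' x2' x3' y1' y2' y3' : mat2 F) : x1' \in P ->
     mul2 (conj2 (k1 i) x1') (conj2 (k2 i) x2') = g ->
     mul2 (conj2 (k1 i) x1') (conj2 (k3 i) x3') = h ->
     mul2 (conj2 (k1 i) y1') (conj2 (k2 i) y2') = g ->
     mul2 (conj2 (k1 i) y1') (conj2 (k3 i) y3') = h ->
     conj2 (k1 i) x1' = conj2 (k1 i) y1' -> (x1', x2', x3') = (y1', y2', y3').
    move=> x1P' e1 e2 e3 e4 E; have dx : det2 (conj2 (k1 i) x1') = 1 by rewrite (det2_conj _ (dk1 i)) Pdet.
    move: e3 e4; rewrite -E => e3 e4.
    by rewrite (conj2_inj (dk1 i) E) (recov _ _ _ _ _ dx (dk2 i) e1 e3) (recov _ _ _ _ _ dx (dk3 i) e2 e4).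
  apply: (first_eq _ _ _ _ _ _ y1P Gy Hy Gz Hz).
  apply: (@two_solutions _ tau g h (conj2 (k1 i) x1)) => //.
  + move=> a; rewrite !inE => /or3P[]/eqP->.
    * exact: key x1P x2P x3P Gx Hx.
    * exact: key y1P y2P y3P Gy Hy.
    * exact: key z1P z2P z3P Gz Hz.
  + by apply: contraNneq nxy => E; apply/eqP; apply: first_eq E.
  + by apply: contraNneq nxz => E; apply/eqP; apply: first_eq E.
- case=> [[u v] w]; rewrite !inE /= => /andP[/andP[uP vP] wP].
  apply/andP; split.
    by rewrite /G /=; apply: ball_mono (ball_mul (B1 _ _ uP) (B2 _ _ vP)); lia.
  by rewrite /H /=; apply: ball_mono (ball_mul (B1 _ _ uP) (B3 _ _ wP)); lia.
Qed.

End Ball.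

(** * Centralisers of regular elements *)

Section Commuting.
Variable F : finFieldType.
Implicit Types (t : F) (u v w g h : mat2 F) (r s : nat).

Definition comm2 u v := mul2 u v == mul2 v u.
Definition disc2 u := (e11 u - e22 u) ^+ 2 + 4 * (e12 u * e21 u).

Lemma disc2E u : disc2 u = tr2 u ^+ 2 - 4 * det2 u.
Proof. by case: u => [[[x1 x2] x3] x4]; rewrite /disc2 /tr2 /det2 /e11 /e12 /e21 /e22 /=; ring. Qed.

Lemma regularE u : det2 u = 1 -> regular u = (disc2 u != 0).
Proof. by move=> du; rewrite disc2E du mulr1 subr_eq0. Qed.

(** Equality of v and k u modulo scalar matrices. *)
Definition parallel k u v :=
  [/\ e11 v - e22 v = k * (e11 u - e22 u), e12 v = k * e12 u & e21 v = k * e21 u].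

(** Commuting means that the coordinate vectors modulo scalars have zero cross product;
    [disc2 u != 0] makes the vector of [u] nonzero. *)
Lemma comm2_parallel u v : disc2 u != 0 -> comm2 u v -> exists k, parallel k u v.
Proof.
move: u v => [[[x1 x2] x3] x4] [[[y1 y2] y3] y4].
rewrite /parallel /disc2 /comm2 /mul2 /e11 /e12 /e21 /e22 /= => D /eqP[E1 E2 E3 _].
have {}E1 : x2 * y3 = x3 * y2 by apply: (addrI (x1 * y1)); rewrite E1; ring.
have {}E2 : y2 * (x1 - x4) = x2 * (y1 - y4).
  apply: (addIr (x2 * y4 + y2 * x4)).
  by transitivity (x1 * y2 + x2 * y4); [ring|rewrite E2; ring].
have {}E3 : y3 * (x1 - x4) = x3 * (y1 - y4).
  apply: (addIr (x3 * y4 + y3 * x4)).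
  by transitivity (y3 * x1 + y4 * x3); [ring|rewrite -E3; ring].
have [x20|x20] := eqVneq x2 0; last first.
  exists (y2 / x2); split; first by rewrite mulrAC E2 mulrAC divff // mul1r.
    by rewrite divfK.
  by rewrite mulrAC [y2 * x3]mulrC -E1 mulrAC divff // mul1r.
have x140 : x1 - x4 != 0.
  by apply: contraNneq D => ->; rewrite x20 mul0r mulr0 expr0n addr0.
exists ((y1 - y4) / (x1 - x4)); split; first by rewrite divfK.
  by apply: (mulIf x140); rewrite E2 x20; ring.
by apply: (mulIf x140); rewrite mulrAC divfK // E3 mulrC.
Qed.

Lemma parallel_comm2 k l w u v : parallel k w u -> parallel l w v -> comm2 u v.
Proof.
move: u v w => [[[x1 x2] x3] x4] [[[y1 y2] y3] y4] [[[z1 z2] z3] z4].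
rewrite /parallel /comm2 /mul2 /e11 /e12 /e21 /e22 /= => -[/(canRL (subrK _)) -> -> ->].
move=> [/(canRL (subrK _)) -> -> ->].
by apply/eqP; congr (_, _, _, _); ring.
Qed.

Lemma disc2_parallel k u v : parallel k u v -> disc2 v = k ^+ 2 * disc2 u.
Proof. by case=> E1 E2 E3; rewrite /disc2 E1 E2 E3; ring. Qed.

Lemma comm2_trans w u v : disc2 w != 0 -> comm2 w u -> comm2 w v -> comm2 u v.
Proof.
by move=> dw /(comm2_parallel dw)[k uk] /(comm2_parallel dw)[l vl]; apply: parallel_comm2 uk vl.
Qed.

Lemma comm2_sym u v : comm2 u v = comm2 v u.
Proof. by rewrite /comm2 eq_sym. Qed.

Lemma comm2_conj g u v : det2 g = 1 -> comm2 u v -> comm2 (conj2 g u) (conj2 g v).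
Proof.
move=> dg /eqP uv.
have E x y : mul2 (conj2 g x) (conj2 g y) = conj2 g (mul2 x y).
  by rewrite /conj2 -!mul2A [mul2 (adj2 g) (mul2 g _)]mul2A mulV2 // mul12.
by apply/eqP; rewrite !E uv.
Qed.

(** Since disc(v) = k^2 disc(u), non-regularity forces k = 0; then [v] is scalar, and determinant 1
    leaves the two signs. *)
Lemma centralizer_nonregular u v : det2 u = 1 -> det2 v = 1 -> regular u ->
  comm2 u v -> ~~ regular v -> v \in [set one2; (-1, 0, 0, -1)].
Proof.
move=> du dv ru uv; rewrite regularE // negbK => dv0.
have du0 : disc2 u != 0 by rewrite -regularE.
have [k kuv] := comm2_parallel du0 uv.
move: dv0; rewrite (disc2_parallel kuv) mulf_eq0 (negPf du0) orbF expf_eq0 /= => /eqP k0.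
case: kuv; rewrite k0 !mul0r.
case: v dv {uv} => [[[y1 y2] y3] y4]; rewrite /det2 /e11 /e12 /e21 /e22 /= => dv.
move=> /eqP; rewrite subr_eq0 => /eqP y14 y2E y3E.
move: dv; rewrite y2E y3E y14 mul0r subr0 -expr2 => /eqP; rewrite sqrf_eq1 !inE.
by case/orP => /eqP ->; rewrite eqxx ?orbT.
Qed.

End Commuting.

(** * Growth through conjugate tori *)

Section Growth.
Variables (F : finFieldType) (b c : F).
Implicit Types (t : F) (u v w g h : mat2 F) (r s : nat).
Hypotheses (b0 : b != 0) (c0 : c != 0) (n24 : 24 != 0 :> F).
Local Notation ball := (ball b c).

(** The radius is [2 * r] because the elements arise as quotients of two elements of [ball r] that
    conjugate [u] alike. *)
Definition cent r u : {set mat2 F} := [set v in ball (2 * r) | comm2 u v].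
Definition rcent r u : {set mat2 F} := [set v in cent r u | regular v].

Lemma card_cent r u : det2 u = 1 -> regular u -> (#|cent r u| <= #|rcent r u| + 2)%N.
Proof.
move=> du ru; have -> : 2%N = (#|[set: 'I_2]| * 1)%N by rewrite cardsT card_ord.
rewrite -(cardsID (rcent r u)) leq_add //.
  by apply: subset_leq_card; apply: subsetIr.
pose Z : {set mat2 F} := [set one2; (-1, 0, 0, -1)].
apply: leq_trans (_ : #|Z| <= _)%N; last first.
  by rewrite cards2 cardsT card_ord; case: (_ != _).
apply: subset_leq_card; apply/subsetP => v; rewrite !inE => /andP[nv /andP[vB uv]].
have := centralizer_nonregular du (ball_det vB) ru uv; rewrite !inE; apply.
by move: nv; rewrite vB uv.
Qed.

(** Orbit-stabiliser bounds the ball by the orbit P of [u] times [cent r u]. The orbit lies in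
    [ball (5 * r)] and has constant trace, so [trace_class_bound] applies; 10 r + 16 <= 14 r uses r
    >= 4. *)
Lemma cent_lower_bound r u : (4 <= r)%N -> u \in ball (3 * r) -> regular u ->
  (#|ball r| ^ 3 <= 810 * #|ball (14 * r)| ^ 2 * #|cent r u| ^ 3)%N.
Proof.
move=> r4 uB ru; pose P := [set conj2 a u | a in ball r].
have PB : P \subset ball (5 * r).
  apply/subsetP => v /imsetP[a aB ->]; apply: ball_mono (ball_conj aB uB); lia.
have Ptr : {in P, forall v, tr2 v = tr2 u}.
  by move=> v /imsetP[a aB ->]; rewrite tr2_conj ?(ball_det aB).
have HP := trace_class_bound b0 c0 n24 ru PB Ptr.
have HB : (#|ball r| <= #|P| * #|cent r u|)%N.
  apply: (@card_le_fibers _ _ _ _ (fun a => conj2 a u)) => [a aB|v].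
    exact: imset_f.
  case/imsetP => a aB ->.
  have da := ball_det aB.
  rewrite -(card_imset _ (mul2I (g := adj2 a) _)) ?det2_adj //.
  apply: subset_leq_card; apply/subsetP => w /imsetP[a' + ->].
  rewrite !inE => /andP[a'B /eqP E]; have da' := ball_det a'B.
  rewrite mul2n -addnn ball_mul ?ball_adj //= /comm2.
  apply/eqP; apply: (mul2I da); rewrite !mul2A mul2V // mul12.
  apply: (mulI2 (g := adj2 a')); first by rewrite det2_adj.
  move: E; rewrite /conj2 => ->.
  by rewrite -!mul2A mul2V // !mul21.
have HN : (#|ball (2 * (5 * r) + 16)| <= #|ball (14 * r)|)%N.
  by apply: subset_leq_card; apply/subsetP => v; apply: ball_mono; lia.
apply: leq_trans (_ : (#|P| * #|cent r u|) ^ 3 <= _)%N; first by rewrite leq_exp2r.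
rewrite expnMn leq_mul2r; apply/orP; right; apply: leq_trans HP _.
by rewrite leq_mul2l /= leq_exp2r.
Qed.

(** The torus centralising [u] meets the ball in a regular element, although [u] itself may lie far
    out. Radius [3 * r] leaves room for conjugating an element of [ball (2 * r)] by a generator. *)
Definition involved r u : Prop :=
  [/\ det2 u = 1, regular u & exists2 v, v \in ball (3 * r) & regular v && comm2 v u].

Lemma involved_cent r u : (4 <= r)%N -> involved r u ->
  (#|ball r| ^ 3 <= 810 * #|ball (14 * r)| ^ 2 * #|cent r u| ^ 3)%N.
Proof.
move=> r4 [du ru [v vB /andP[rv vu]]].
apply: leq_trans (cent_lower_bound r4 vB rv) _.
rewrite leq_mul2l leq_exp2r //; apply/orP; right.
apply: subset_leq_card; apply/subsetP => w; rewrite !inE => /andP[-> vw] /=.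
by apply: comm2_trans vu vw; rewrite -regularE ?(ball_det vB).
Qed.

Lemma regular_conj g u : det2 g = 1 -> regular (conj2 g u) = regular u.
Proof. by move=> dg; rewrite /regular tr2_conj. Qed.

(** Without growth of exponent 3/2, [cent r u] has more than two elements. At most two of them are
    not regular, so at least one third are regular. *)
Lemma involved_rcent r u : (4 <= r)%N ->
  (810 * 8 * #|ball (14 * r)| ^ 2 < #|ball r| ^ 3)%N -> involved r u ->
  (#|cent r u| <= 3 * #|rcent r u|)%N /\ (0 < #|rcent r u|)%N.
Proof.
move=> r4 big iu; have H := involved_cent r4 iu; case: iu => du ru _.
have M3 : (2 < #|cent r u|)%N.
  rewrite ltnNge; apply/negP => M2; move: big; rewrite ltnNge => /negP; apply.
  apply: leq_trans H _; rewrite mulnAC leq_mul2r.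
  by apply/orP; right; rewrite leq_mul2l -[8%N]/(2 ^ 3)%N leq_exp2r.
by have := card_cent r du ru; lia.
Qed.

Lemma involved_gen r u g : (4 <= r)%N ->
  (810 * 8 * #|ball (14 * r)| ^ 2 < #|ball r| ^ 3)%N -> g \in gens2 b c ->
  involved r u -> involved r (conj2 g u).
Proof.
move=> r4 big gG iu; have [_] := involved_rcent r4 big iu.
case: iu => du ru _ /card_gt0P[v]; rewrite !inE => /andP[/andP[vB uv] rv].
have dg := gens2_det gG.
split; rewrite ?det2_conj ?regular_conj //; exists (conj2 g v).
  by apply: ball_mono (ball_conj (ball_gen gG) vB); lia.
by rewrite regular_conj // rv /= comm2_conj // comm2_sym.
Qed.

Hypothesis prime_field : forall z : F, exists m : nat, z = m%:R.

(** Over a prime field t = m b, so [involved_gen] is applied m times; the size of m does not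
    matter. *)
Lemma involved_up r u t : (4 <= r)%N ->
  (810 * 8 * #|ball (14 * r)| ^ 2 < #|ball r| ^ 3)%N -> involved r u ->
  involved r (conj2 (upper t) u).
Proof.
move=> r4 big iu; have [m tm] := prime_field (t / b).
rewrite -[t](divfK b0) tm; elim: m {tm} => [|m IH]; first by rewrite mul0r up0 conj21.
rewrite -add1n natrD mulrDl mul1r -upD conj2M; apply: involved_gen => //.
by rewrite !inE eqxx orbT.
Qed.

Lemma involved_low r u t : (4 <= r)%N ->
  (810 * 8 * #|ball (14 * r)| ^ 2 < #|ball r| ^ 3)%N -> involved r u ->
  involved r (conj2 (lower t) u).
Proof.
move=> r4 big iu; have [m tm] := prime_field (t / c).
rewrite -[t](divfK c0) tm; elim: m {tm} => [|m IH]; first by rewrite mul0r low0 conj21.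
rewrite -add1n natrD mulrDl mul1r -lowD conj2M; apply: involved_gen => //.
by rewrite !inE eqxx !orbT.
Qed.

Lemma two_neq0 : 2 != 0 :> F.
Proof.
apply: contraNneq n24 => n2; have -> : 24 = 2 * 12 :> F by ring.
by rewrite n2 mul0r.
Qed.

(** The product of [upper (k b)] and [lower c] has tr^2 - 4 = k b c (k b c + 4). Thus k = 1 works
    unless b c = -4, and then k = 2 gives 2^5. *)
Lemma regular_start : exists u, [/\ u \in ball 3, regular u & e12 u != 0].
Proof.
have n2 := two_neq0.
have H (k : nat) : k%:R * (b * c) * (k%:R * (b * c) + 4) != 0 ->
    regular (mul2 (upper (k%:R * b)) (lower (1%:R * c))).
  apply: contraNN; rewrite /tr2 /mul2 /upper /lower /e11 /e12 /e21 /e22 /=.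
  rewrite -subr_eq0 => /eqP <-; apply/eqP; ring.
have E (k : nat) : e12 (mul2 (upper (k%:R * b)) (lower (1%:R * c))) = k%:R * b.
  by rewrite /mul2 /upper /lower /e11 /e12 /e21 /e22 /=; ring.
have B (k : nat) : (k <= 2)%N -> mul2 (upper (k%:R * b)) (lower (1%:R * c)) \in ball 3.
  by move=> k2; apply: (ball_mono (r := (k + 1)%N)); [lia|rewrite ball_mul ?ball_up ?ball_low].
have bc0 : b * c != 0 by rewrite mulf_neq0.
have [bc4|bc4] := eqVneq (b * c + 4) 0.
  exists (mul2 (upper (2%:R * b)) (lower (1%:R * c))); split; [exact: B | | by rewrite E mulf_neq0].
  apply: H; have -> : b * c = - 4 by apply/eqP; rewrite -subr_eq0 opprK bc4.
  have -> : 2%:R * - 4 * (2%:R * - 4 + 4) = 2 ^+ 5 :> F by ring.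
  by rewrite expf_neq0.
exists (mul2 (upper (1%:R * b)) (lower (1%:R * c))); split; [exact: B | | by rewrite E mul1r].
  by apply: H; rewrite mul1r mulf_neq0.
Qed.

Lemma e21_conj_low t u :
  e21 (conj2 (lower t) u) = e21 u + t * (e11 u - e22 u) - t ^+ 2 * e12 u.
Proof.
case: u => [[[x1 x2] x3] x4].
by rewrite /conj2 /mul2 /adj2 /lower /e11 /e12 /e21 /e22 /=; ring.
Qed.

Lemma disc2_conj g u : det2 g = 1 -> disc2 (conj2 g u) = disc2 u.
Proof. by move=> dg; rewrite !disc2E tr2_conj // det2_conj. Qed.

(** This two-parameter family supplies |F|^2 conjugates of [u], at most four of them in any one
    torus. *)
Definition upper_lower_conj u (x : F * F) := conj2 (upper x.1) (conj2 (lower x.2) u).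

(* The lower left entry determines [x.2] up to the four roots of a quartic,
   and then [x.1] is unique. *)
Lemma card_conj_comm2 u v : disc2 u != 0 -> disc2 v != 0 -> e12 u != 0 ->
  (#|[set x : F * F | comm2 (upper_lower_conj u x) v]| <= 4)%N.
Proof.
move=> du dv u12; set X := [set x | _].
have Xpar x : x \in X -> exists2 k, k != 0 & parallel k (upper_lower_conj u x) v.
  rewrite inE => /comm2_parallel[|k kP].
    by rewrite !disc2_conj ?det2_up ?det2_low.
  exists k => //; apply: contraNneq dv => k0; rewrite (disc2_parallel kP) k0.
  by rewrite expr0n mul0r.
have inj : {in X &, injective snd}.
  case=> [s m] [t m'] /Xpar[k k0 + ] /Xpar[l l0 +] /= mm'; rewrite -{m'}mm' /upper_lower_conj /=.
  have : disc2 (conj2 (lower m) u) != 0 by rewrite disc2_conj ?det2_low.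
  move: (conj2 (lower m) u) => [[[x1 x2] x3] x4] {X Xpar}.
  case: v dv => [[[y1 y2] y3] y4].
  rewrite !conj2_up /parallel /disc2 /e11 /e12 /e21 /e22 /= => dv dw [E1 E2 E3] [E1' E2' E3'].
  congr (_, _); have [x30|x30] := eqVneq x3 0.
    have x140 : x1 - x4 != 0.
      by apply: contraNneq dw => ->; rewrite x30 expr0n mulr0 mulr0 addr0.
    have kl : k = l.
      apply: (mulIf x140); transitivity (y1 - y4); first by rewrite E1 x30; ring.
      by rewrite E1' x30; ring.
    move: E2 E2'; rewrite kl => -> /(mulfI l0); rewrite x30 !mulr0 !subr0 => /addrI.
    by apply: mulIf; rewrite -opprB oppr_eq0.
  have kl : k = l by apply: (mulIf x30); rewrite -E3 -E3'.
  move: E1 E1'; rewrite kl => -> /(mulfI l0) E.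
  have : 2 * x3 * (s - t) = 0.
    transitivity ((x1 + s * x3 - (x4 - s * x3)) - (x1 + t * x3 - (x4 - t * x3))); first by ring.
    by rewrite E subrr.
  by move/eqP; rewrite !mulf_eq0 (negPf two_neq0) (negPf x30) subr_eq0 /= => /eqP.
(* [P] is the polynomial of [e21_conj_low]. [Q] eliminates k from e21(v) = k P(m) and disc(v) = k^2
   disc(u); it has degree 4 because [e12 u] and [disc2 v] are nonzero. *)
pose P : {poly F} := Poly [:: e21 u; e11 u - e22 u; - e12 u].
pose Q : {poly F} := disc2 v *: P ^+ 2 - (e21 v ^+ 2 * disc2 u)%:P.
have sP : size P = 3%N by rewrite (@PolyK _ 0) //= oppr_eq0.
have sP2 : size (disc2 v *: P ^+ 2) = 5%N.
  rewrite size_scale //; have := size_exp P 2; rewrite sP /=.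
  by case: (size _) => [|n] //= ->.
have sQ : size Q = 5%N.
  by rewrite size_polyDl // sP2 size_polyN (leq_ltn_trans (size_polyC_leq1 _)).
have Q0 : Q != 0 by rewrite -size_poly_eq0 sQ.
rewrite -(card_in_imset inj).
have := max_poly_roots Q0 (rs := enum [set snd x | x in X]) _ (enum_uniq _).
rewrite sQ -cardE ltnS; apply; apply/allP => m; rewrite mem_enum => /imsetP[[s m'] /Xpar[k k0 kP] -> /=].
have PE : P.[m'] = e21 u + m' * (e11 u - e22 u) - m' ^+ 2 * e12 u.
  by rewrite /P horner_Poly /=; ring.
rewrite /root /Q hornerD hornerN hornerC hornerZ horner_exp PE.
have E3 : e21 v = k * (e21 u + m' * (e11 u - e22 u) - m' ^+ 2 * e12 u).
  by case: kP => _ _ ->; rewrite /upper_lower_conj conj2_up -e21_conj_low.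
have D : disc2 v = k ^+ 2 * disc2 u.
  by rewrite (disc2_parallel kP) !disc2_conj ?det2_up ?det2_low.
by rewrite E3 D; apply/eqP; move: (e21 u) (e11 u) (e22 u) (e12 u) (disc2 u) => *; ring.
Qed.

(** Write N, N' for the two ball sizes and q for |F|. If the first alternative fails, all q^2
    conjugates are involved. Counting pairs of a conjugate and a regular element commuting with it,
    some conjugate has at most 4 N' / q^2 such elements. Its centraliser is at most three times as
    large, and [involved_cent] bounds it below; 27 and 64 are the cubes of 3 and 4. *)
Lemma ball_growth r : (4 <= r)%N ->
  (#|ball r| ^ 3 <= 810 * 8 * #|ball (14 * r)| ^ 2)%N \/
  (#|ball r| ^ 3 * #|F| ^ 6 <= 810 * 27 * 64 * #|ball (14 * r)| ^ 5)%N.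
Proof.
move=> r4; case: leqP => [|big]; [by left | right].
have [u [uB ru u12]] := regular_start.
have iu : involved r u.
  split; rewrite ?(ball_det uB) //; exists u; last by rewrite ru /comm2 eqxx.
  by apply: ball_mono uB; lia.
have ix x : involved r (upper_lower_conj u x) by apply: involved_up => //; apply: involved_low.
pose R x := #|rcent r (upper_lower_conj u x)|.
have S : (\sum_x R x <= #|ball (2 * r)| * 4)%N.
  pose V := [set v in ball (2 * r) | regular v].
  apply: leq_trans (_ : \sum_(v in V) #|[set x | comm2 (upper_lower_conj u x) v]| <= _)%N.
    rewrite leq_eqVlt; apply/orP; left; apply/eqP.
    under eq_bigr => x _ do rewrite /R -sum1_card.
    rewrite (exchange_big_dep [in V]) /=; last first.
      by move=> x v _; rewrite !inE => /andP[/andP[-> _] ->].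
    apply: eq_bigr => v; rewrite inE => /andP[vB rv]; rewrite -sum1_card.
    by apply: eq_bigl => x; rewrite !inE vB rv andbT.
  apply: leq_trans (_ : \sum_(v in V) 4 <= _)%N.
    apply: leq_sum => v; rewrite inE => /andP[vB rv].
    by apply: card_conj_comm2; rewrite -?regularE ?(ball_det uB) ?(ball_det vB).
  rewrite sum_nat_const leq_mul2r /=; apply: subset_leq_card.
  by apply/subsetP => v; rewrite inE => /andP[].
pose x0 := [arg min_(x < (0, 0) : F * F) R x].
have Rmin x : (R x0 <= R x)%N by rewrite /x0; case: arg_minnP => // y _; apply.
have HR : (#|F| ^ 2 * R x0 <= 4 * #|ball (14 * r)|)%N.
  apply: leq_trans (_ : \sum_x R x <= _)%N.
    rewrite -mulnn -card_prod -sum_nat_const; exact: leq_sum.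
  apply: leq_trans S _; rewrite mulnC leq_mul2l /=; apply: subset_leq_card.
  by apply/subsetP => v; apply: ball_mono; lia.
have H1 := involved_cent r4 (ix x0).
have [H2 _] := involved_rcent r4 big (ix x0).
move: HR H1 H2; rewrite -/(R x0); move: (R x0) (#|cent _ _|) (#|ball r|) (#|ball (14 * r)|) => k m N N'.
move: #|F| => q Hk HN Hm.
apply: leq_trans (_ : 810 * N' ^ 2 * (3 * k) ^ 3 * q ^ 6 <= _)%N.
  rewrite leq_mul2r; apply/orP; right; apply: leq_trans HN _.
  by rewrite leq_mul2l leq_exp2r ?Hm ?orbT.
have -> : (810 * N' ^ 2 * (3 * k) ^ 3 * q ^ 6 = 810 * 27 * N' ^ 2 * (q ^ 2 * k) ^ 3)%N.
  by rewrite !expnMn -[(q ^ 6)%N]/(q ^ (2 * 3))%N expnM; lia.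
apply: leq_trans (_ : 810 * 27 * N' ^ 2 * (4 * N') ^ 3 <= _)%N.
  by rewrite leq_mul2l leq_exp2r // Hk orbT.
rewrite expnMn; apply: eq_leq.
rewrite -[(N' ^ 5)%N]/(N' ^ (2 + 3))%N expnD -[(4 ^ 3)%N]/64%N.
by move: (N' ^ 2)%N (N' ^ 3)%N => x y; lia.
Qed.

End Growth.

(** * Large sumsets S + x S *)

Lemma card_sqr_collisions (T U : finType) (A : {set T}) (f : T -> U) :
  (#|A| ^ 2 <= #|f @: A| * #|[set z in setX A A | f z.1 == f z.2]|)%N.
Proof.
pose n u := #|[set x in A | f x == u]|.
have nE : #|A| = (\sum_(u in f @: A) n u)%N.
  rewrite -sum1_card (partition_big_imset f) /=; apply: eq_bigr => u _.
  by rewrite sum1dep_card.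
have cE : #|[set z in setX A A | f z.1 == f z.2]| = (\sum_(u in f @: A) n u ^ 2)%N.
  rewrite -sum1_card (partition_big (fun z => f z.1) (mem (f @: A))) /=; last first.
    by move=> z; rewrite !inE => /andP[/andP[zA _] _]; apply: imset_f.
  apply: eq_bigr => u _; rewrite sum1dep_card -mulnn -cardsX; congr #|pred_of_set _|.
  apply/setP => -[x y]; rewrite !inE /=.
  case: (x \in A); case: (y \in A); rewrite ?andbF //=.
  by case: (eqVneq (f x) u) => [<-|_]; rewrite ?andbF // andbT eq_sym.
(* Cauchy-Schwarz for the fibre sizes, by summing 2 n(u) n(v) <= n(u)^2 + n(v)^2 over all pairs. *)
rewrite -(leq_pmul2l (m := 2)) // -mulnn nE cE big_distrlr /= big_distrr /=.
apply: leq_trans (_ : \sum_(u in f @: A) \sum_(v in f @: A) (n u ^ 2 + n v ^ 2) <= _)%N.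
  apply: leq_sum => u _; rewrite big_distrr /=; apply: leq_sum => v _.
  exact: (nat_Cauchy _ _).1.
under eq_bigr => u _ do rewrite big_split /= sum_nat_const.
by rewrite big_split /= sum_nat_const -big_distrr /= -mulnDl addnn -mul2n mulnA.
Qed.

(** Let q = |F|, s = |S|. Two distinct pairs collide for at most one x, so the collision counts E
    sum to at most q s^2 + s^4. By Cauchy-Schwarz E(x) >= s^4 / q always, and E(x) >= 2 s^4 / q if
    the sumset at x fills at most half of the field. If that happened for all x in [R], it would
    follow that s^2 |R| <= q^2. *)
Lemma exists_large_sumset (F : finFieldType) (R S : {set F}) :
  (#|F| ^ 2 < #|R| * #|S| ^ 2)%N ->
  exists2 x, x \in R & (#|F| < 2 * #|[set (z.1 + x * z.2)%R | z in setX S S]|)%N.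
Proof.
move=> big; pose im x := [set z.1 + x * z.2 | z in setX S S].
pose E x := #|[set w in setX (setX S S) (setX S S) | w.1.1 + x * w.1.2 == w.2.1 + x * w.2.2]|.
have CS x : (#|S| ^ 4 <= #|im x| * E x)%N.
  have := card_sqr_collisions (setX S S) (fun z => z.1 + x * z.2).
  by rewrite cardsX mulnn -expnM.
have sumE : (\sum_x E x <= #|F| * #|S| ^ 2 + #|S| ^ 4)%N.
  pose W := setX (setX S S) (setX S S).
  have -> : (\sum_x E x = \sum_(w in W) #|[set x : F | (w.1.1 + x * w.1.2 == w.2.1 + x * w.2.2)%R]|)%N.
    under eq_bigr => x _ do rewrite /E -sum1_card.
    rewrite (exchange_big_dep [in W]) /=; last by move=> x w _; rewrite inE => /andP[].
    apply: eq_bigr => w wW; rewrite -sum1_card.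
    by apply: eq_bigl => x; rewrite !inE; move: wW; rewrite !inE => ->.
  apply: leq_trans (_ : \sum_(w in W) (#|F| * (w.1 == w.2) + 1) <= _)%N.
    apply: leq_sum => -[[s1 t1] [s2 t2]] _ /=.
    case: eqP => [_|ne]; first by rewrite muln1 (leq_trans (max_card _)) // leq_addr.
    rewrite muln0 add0n; apply/card_le1_eqP => y x; rewrite !inE => /eqP Ey /eqP Ex.
    have t12 : t1 - t2 != 0.
      rewrite subr_eq0; apply: contra_notN ne => /eqP t12; move: Ex; rewrite t12 => /addIr -> //.
    apply: (mulIf t12); apply: (addrI (s1 + x * t2 + y * t2)).
    transitivity (s1 + x * t1 + y * t2); first by ring.
    rewrite Ex; transitivity (s2 + y * t2 + x * t2); first by ring.
    by rewrite -Ey; ring.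
  rewrite big_split /= sum1_card !cardsX !mulnn -expnM leq_add2r.
  rewrite -big_distrr /= leq_mul2l; apply/orP; right.
  rewrite -big_mkcondr sum1_card.
  apply: leq_trans (_ : #|[set (z, z) | z in setX S S]| <= _)%N.
    apply: subset_leq_card; apply/subsetP => -[z z']; rewrite unfold_in /= => /andP[zS /eqP zz'].
    by rewrite -zz'; apply: imset_f; move: zS; rewrite inE => /andP[].
  by apply: leq_trans (leq_imset_card _ _) _; rewrite cardsX mulnn.
have [x xP|small] := pickP [pred x | (x \in R) && (#|F| < 2 * #|im x|)%N].
  by case/andP: xP => xR xb; exists x.
exfalso; have [s0 sS] : exists s, s \in S.
  by apply/set0Pn; apply: contraTneq big => ->; rewrite cards0 muln0.
have S0 : (0 < #|S|)%N by apply/card_gt0P; exists s0.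
have H : (\sum_(x : F) (#|S| ^ 4 * (1 + (x \in R))) <= #|F| * \sum_x E x)%N.
  rewrite big_distrr /=; apply: leq_sum => x _; case xR: (x \in R); last first.
    rewrite addn0 muln1; apply: leq_trans (CS x) _.
    by rewrite leq_mul2r max_card orbT.
  have := small x; rewrite /= xR /= => /negbT; rewrite -leqNgt => im2.
  apply: leq_trans (_ : 2 * #|im x| * E x <= _)%N; last by rewrite leq_mul2r im2 orbT.
  by rewrite -mulnA [leqRHS]mulnC; apply: leq_mul.
move: H; rewrite -big_distrr /= big_split /= sum1_card -[X in (_ + X)%N]big_mkcond /= sum1_card.
have -> : #|xpredT : pred F| = #|F| by apply: eq_card.
move=> H; move: big; rewrite ltnNge => /negP; apply.
have {H} := leq_trans H (leq_mul (leqnn _) sumE).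
have -> : (#|S| ^ 4 = #|S| ^ 2 * #|S| ^ 2)%N by rewrite -expnD.
have : (0 < #|S| ^ 2)%N by rewrite expn_gt0 S0.
move: (#|S| ^ 2)%N => s s0' H; rewrite -mulnn.
have : (s * (s * (#|F| + #|R|)) <= s * (#|F| * (#|F| + s)))%N by lia.
by rewrite leq_pmul2l //; lia.
Qed.

(** * Large balls yield all upper unipotents *)

Section LargeBall.
Variables (F : finFieldType) (b c : F).
Implicit Types (t : F) (u v w g h : mat2 F) (r s : nat).
Local Notation ball := (ball b c).

Lemma upper_unipotent u v : det2 u = 1 -> det2 v = 1 ->
  e21 u = e21 v -> e22 u = e22 v -> exists t, mul2 u (adj2 v) = upper t.
Proof.
move: u v => [[[x1 x2] x3] x4] [[[y1 y2] y3] y4].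
rewrite /det2 /mul2 /adj2 /upper /e11 /e12 /e21 /e22 /= => du dv E3 E4.
exists (x1 * - y2 + x2 * y1); rewrite -{1}E3 -E4 -{1}du; congr (_, _, _, _); first by ring.
  by rewrite E3 E4; ring.
by rewrite E3 E4 -dv; ring.
Qed.

Lemma mul2_adj_inj v u w : det2 v = 1 -> mul2 u (adj2 v) = mul2 w (adj2 v) -> u = w.
Proof. by move=> dv; apply: mulI2; rewrite det2_adj. Qed.

(** Let q = |F|, s = |S| and N the size of the ball. Sorting by bottom row gives N <= q^2 s; sorting
    by the projective point of the bottom row, then by diagonal entry, gives N <= (q + 1) 2 |R| s.
    With N^2 > 4 q^5 this yields q^2 < |R| s^2, so some S + z S fills more than half of the field,
    and any x is a sum of two of its elements. *)
Lemma large_ball_up r x : (4 * #|F| ^ 5 < #|ball r| ^ 2)%N -> upper x \in ball (24 * r).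
Proof.
move=> big; pose S := [set t | upper t \in ball (4 * r)].
pose Bor := [set u in ball (2 * r) | e21 u == 0].
have unip (A : {set mat2 F}) s : (2 * s <= 4 * r)%N -> A \subset ball s ->
    {in A &, forall u v, e21 u = e21 v /\ e22 u = e22 v} -> (#|A| <= #|S|)%N.
  move=> sr AB Arow; case: (set_0Vmem A) => [->|[v vA]]; first by rewrite cards0.
  have dA u : u \in A -> det2 u = 1 by move=> /(subsetP AB)/ball_det.
  have upA u : u \in A -> mul2 u (adj2 v) = upper (e12 (mul2 u (adj2 v))).
    move=> uA; have [E3 E4] := Arow _ _ uA vA.
    by have [t ->] := upper_unipotent (dA _ uA) (dA _ vA) E3 E4.
  have inj : {in A &, injective (fun u => e12 (mul2 u (adj2 v)))}.
    move=> u w uA wA /= E; apply: (mul2_adj_inj (dA _ vA)).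
    by rewrite upA // E -upA.
  rewrite -(card_in_imset inj); apply: subset_leq_card; apply/subsetP => t /imsetP[u uA ->].
  rewrite inE -upA //; apply: (ball_mono sr); rewrite mul2n -addnn.
  by rewrite ball_mul ?ball_adj //; apply: (subsetP AB).
have H1 : (#|ball r| <= #|F| ^ 2 * #|S|)%N.
  have -> : (#|F| ^ 2 = #|[set: F * F]|)%N by rewrite cardsT card_prod mulnn.
  apply: (@card_le_fibers _ _ _ _ (fun u => (e21 u, e22 u))) => [u|[y z] _]; first by rewrite inE.
  apply: (unip _ r); first by lia.
    by apply/subsetP => u; rewrite inE => /andP[].
  by move=> u v; rewrite !inE => /andP[_ /eqP[-> ->]] /andP[_ /eqP[-> ->]].
have H2 : (#|ball r| <= (#|F|.+1) * #|Bor|)%N.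
  have -> : (#|F|.+1 = #|[set: option F]|)%N by rewrite cardsT card_option.
  (* The bottom row is read as a point of the projective line, [None] standing for the point with
     [e21 u = 0]. *)
  apply: (@card_le_fibers _ _ _ _
    (fun u => if e21 u == 0 then None else Some (e22 u / e21 u))) => [u|y _]; first by rewrite inE.
  set A := [set _ in _ | _]; case: (set_0Vmem A) => [->|[v vA]]; first by rewrite cards0.
  have dA u : u \in A -> det2 u = 1 by rewrite inE => /andP[/ball_det].
  have inj : {in A &, injective (fun u => mul2 u (adj2 v))}.
    by move=> u w _ _; apply: mul2_adj_inj; apply: dA.
  rewrite -(card_in_imset inj); apply: subset_leq_card; apply/subsetP => t /imsetP[u uA ->].
  move: uA vA; rewrite !inE => /andP[uB /eqP uy] /andP[vB]; rewrite -uy.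
  rewrite mul2n -addnn ball_mul ?ball_adj //= /mul2 /adj2 /e21 /e22 /e11 /=.
  case: u v {A dA inj uB vB uy} => [[[x1 x2] x3] x4] [[[y1 y2] y3] y4] /=.
  have [->|y30] := eqVneq y3 0; have [->|x30] := eqVneq x3 0 => //.
    by rewrite !mul0r add0r oppr0 mulr0 eqxx.
  case/eqP => E; apply/eqP; transitivity (x3 * y3 * (y4 / y3 - x4 / x3)).
    by field; rewrite x30 y30.
  by rewrite E subrr mulr0.
(* Conjugation by an upper triangular [u] multiplies the parameter of [upper t] by [e11 u ^+ 2].
   Passing to squares costs the factor 2 in [H3]. *)
pose R := [set e11 u ^+ 2 | u in Bor].
have Bor_det u : u \in Bor -> e11 u * e22 u = 1.
  by rewrite inE => /andP[/ball_det + /eqP E]; rewrite /det2 E mulr0 subr0.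
have H3 : (#|Bor| <= (#|R| * 2) * #|S|)%N.
  apply: leq_trans (_ : #|[set e11 u | u in Bor]| * #|S| <= _)%N.
    apply: (@card_le_fibers _ _ _ _ (@e11 F)) => [u uB|y _]; first exact: imset_f.
    apply: (unip _ (2 * r)%N); first by lia.
      by apply/subsetP => u; rewrite !inE => /andP[/andP[]].
    move=> u v; rewrite !inE -!andbA => /and3P[uB u0 /eqP uy] /and3P[vB v0 /eqP vy].
    rewrite (eqP u0) (eqP v0); split=> //.
    have du : e11 u * e22 u = 1 by apply: Bor_det; rewrite inE uB.
    have dv : e11 v * e22 v = 1 by apply: Bor_det; rewrite inE vB.
    have y0 : y != 0 by rewrite -uy; apply: contraTneq isT => E; move: du; rewrite E mul0r => /esym/eqP; rewrite oner_eq0.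
    by apply: (mulfI y0); rewrite -{1}uy -vy du dv.
  rewrite leq_mul2r; apply/orP; right.
  apply: (@card_le_fibers _ _ _ _ (fun y => y ^+ 2)) => [y /imsetP[u uB ->]|z _].
    by apply/imsetP; exists u.
  apply: card_le_two => y1 y2 y3; rewrite !inE => /andP[_ /eqP E1] /andP[_ /eqP E2] /andP[_ /eqP E3].
  move: E2 E3; rewrite -E1 => /eqP + /eqP; rewrite !eqf_sqr => /orP[/eqP->|/eqP->]; rewrite ?eqxx //.
  by move=> /orP[/eqP->|/eqP->]; rewrite ?eqxx.
have H4 t z : z \in R -> upper t \in ball (4 * r) -> upper (z * t) \in ball (8 * r).
  case/imsetP => u uB -> tB; have du := Bor_det _ uB; move: uB; rewrite inE => /andP[uB /eqP u0].
  have -> : upper (e11 u ^+ 2 * t) = conj2 u (upper t).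
    move: u0 du {uB}; case: u => [[[x1 x2] x3] x4].
    rewrite /conj2 /mul2 /adj2 /upper /e11 /e12 /e21 /e22 /= => -> du.
    by congr (_, _, _, _); [rewrite -[LHS]du | | | rewrite -[LHS]du]; ring.
  by apply: ball_mono (ball_conj uB tB); lia.
have [z zR zS] : exists2 z, z \in R & (#|F| < 2 * #|[set (w.1 + z * w.2)%R | w in setX S S]|)%N.
  apply: exists_large_sumset.
  have F0 : (1 < #|F|)%N by apply: card_finNzRing_gt1.
  have {}H2 : (#|ball r| <= 2 * #|F| * (#|R| * 2 * #|S|))%N.
    by apply: leq_trans H2 _; apply: leq_mul => //; lia.
  have := leq_mul H1 H2; rewrite mulnn => /(leq_trans big).
  have -> : (#|F| ^ 2 * #|S| * (2 * #|F| * (#|R| * 2 * #|S|)) = 4 * #|F| ^ 3 * (#|R| * #|S| ^ 2))%N.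
    by rewrite -[(#|F| ^ 3)%N]/(#|F| * #|F| ^ 2)%N -mulnn; lia.
  have -> : (4 * #|F| ^ 5 = 4 * #|F| ^ 3 * #|F| ^ 2)%N by rewrite -mulnA -expnD.
  by rewrite ltn_mul2l => /andP[].
pose A := [set w.1 + z * w.2 | w in setX S S].
have AB t : t \in A -> upper t \in ball (12 * r).
  case/imsetP => [[s s']]; rewrite !inE /= => /andP[sS sS'] ->; rewrite -upD.
  by apply: ball_mono (ball_mul sS (H4 _ _ zR sS')); lia.
have [t tA xtA] : exists2 t, t \in A & x - t \in A.
  have inj : injective (fun t => x - t) by move=> t t' /addrI/oppr_inj.
  have : (0 < #|A :&: [set (x - t)%R | t in A]|)%N.
    have := cardsUI A [set x - t | t in A]; rewrite (card_imset _ inj).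
    have : (#|A :|: [set (x - t)%R | t in A]| <= #|F|)%N by apply: max_card.
    move=> h2 h3; rewrite -(ltn_add2l #|A :|: [set (x - t)%R | t in A]|) addn0 h3 addnn -mul2n.
    exact: leq_ltn_trans h2 zS.
  case/card_gt0P => t; rewrite inE => /andP[tA /imsetP[t' t'A tE]]; exists t => //.
  by rewrite tE subKr.
rewrite -[x](subrK t) -upD; apply: ball_mono (ball_mul (AB _ xtA) (AB _ tA)); lia.
Qed.

End LargeBall.

(** * Balls over prime fields *)

Section BallSize.
Variables (p : nat) (pP : prime p) (b c : 'F_p).
Hypothesis b0 : b != 0.

Lemma Fp_nat (z : 'F_p) : exists2 m : nat, (m < p)%N & z = m%:R.
Proof.
exists z; last by rewrite natr_Zp.
by have := ltn_ord z; rewrite {2}Fp_cast.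
Qed.

(** The first r + 1 powers of [upper b] are distinct. *)
Lemma ball_size r : (r < p)%N -> (r < #|ball b c r|)%N.
Proof.
move=> rp; pose f (j : 'I_r.+1) : mat2 'F_p := upper (j%:R * b).
have inj : injective f.
  move=> i j /(congr1 (@e12 _)) /(mulIf b0) E; apply: val_inj => /=.
  have lt (k : 'I_r.+1) : (k < p)%N by apply: leq_trans rp; apply: ltn_ord.
  have := congr1 val E; rewrite /= !val_Fp_nat // !modn_small //.
have := card_imset [set: 'I_r.+1] inj; rewrite cardsT card_ord => <-.
apply: subset_leq_card; apply/subsetP => u /imsetP[j _ ->].
by apply: ball_mono (ball_up _ _ _); rewrite -ltnS.
Qed.

(** This crude radius serves for the finitely many small primes. *)
Lemma small_field_up x : upper x \in ball b c p.
Proof.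
have [m mp E] := Fp_nat (x / b).
rewrite -[x](divfK b0) E; apply: ball_mono (ball_up _ _ _); exact: ltnW.
Qed.

Lemma Fp_24_neq0 : (4 < p)%N -> (24 != 0 :> 'F_p).
Proof.
move=> p4; rewrite -(dvdn_pcharf (pchar_Fp pP)).
have -> : 24%N = (2 ^ 3 * 3)%N by [].
rewrite Euclid_dvdM // Euclid_dvdX // andbT.
by apply/negP => /orP[] /dvdn_leq => /(_ isT); lia.
Qed.

Lemma Fp_ball_growth r : c != 0 -> (4 < p)%N -> (4 <= r)%N ->
  (#|ball b c r| ^ 3 <= 810 * 8 * #|ball b c (14 * r)| ^ 2)%N \/
  (#|ball b c r| ^ 3 * p ^ 6 <= 810 * 27 * 64 * #|ball b c (14 * r)| ^ 5)%N.
Proof.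
move=> c0 p4 r4.
have nat_field (z : 'F_p) : exists m : nat, z = m%:R.
  by have [m _ ->] := Fp_nat z; exists m.
by have := ball_growth b0 c0 (Fp_24_neq0 p4) nat_field r4; rewrite card_Fp.
Qed.

Lemma Fp_large_ball r : (4 * p ^ 5 < #|ball b c r| ^ 2)%N ->
  forall x, upper x \in ball b c (24 * r).
Proof.
by move=> big x; apply: large_ball_up; rewrite card_Fp.
Qed.

End BallSize.

(** * Short words and transvections in SL_n *)

Lemma invmxM (R : comUnitRingType) (n : nat) (g h : 'M[R]_n) :
  g \in unitmx -> h \in unitmx -> invmx (g *m h) = invmx h *m invmx g.
Proof.
move=> ug uh; have ugh : g *m h \in unitmx by rewrite unitmx_mul ug.
by apply: (can_inj (mulmxK ugh)); rewrite mulVmx // -mulmxA mulKmx // mulVmx.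
Qed.

Section Words.
Variables (F : finFieldType) (n : nat) (X : {set 'M[F]_n}).
Implicit Types (a g h : 'M[F]_n) (k m : nat).

Fixpoint word_ball k : {set 'M[F]_n} :=
  if k is k'.+1 then [set a *m g | a in 1%:M |: symset X, g in word_ball k']
  else [set 1%:M].

Lemma word_ballS k g :
  reflect (exists2 a, a \in 1%:M |: symset X & exists2 h, h \in word_ball k & g = a *m h)
          (g \in word_ball k.+1).
Proof.
apply: (iffP imset2P) => [[a h aG hB ->]|[a aG [h hB ->]]]; first by exists a => //; exists h.
by exists a h.
Qed.

Lemma word_ball1 k : 1%:M \in word_ball k.
Proof.
elim: k => [|k IH]; first by rewrite inE.
by apply/word_ballS; exists 1%:M; rewrite ?setU11 //; exists 1%:M; rewrite ?mul1mx.
Qed.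

Lemma word_ball_mul k m g h :
  g \in word_ball k -> h \in word_ball m -> g *m h \in word_ball (k + m).
Proof.
elim: k g => [|k IH] g; first by rewrite inE => /eqP -> hB; rewrite mul1mx.
case/word_ballS => a aG [g' g'B ->] hB; rewrite addSn; apply/word_ballS; exists a => //.
by exists (g' *m h); rewrite ?IH ?mulmxA.
Qed.

Lemma word_ball_mono k m g : (k <= m)%N -> g \in word_ball k -> g \in word_ball m.
Proof. by move=> /subnK <- gB; rewrite -[g]mul1mx word_ball_mul ?word_ball1. Qed.

Lemma word_ball_gen g : g \in symset X -> g \in word_ball 1.
Proof.
by move=> gX; apply/word_ballS; exists g; [exact: setU1r|exists 1%:M; rewrite ?mulmx1 ?inE].
Qed.

Lemma word_ballP k g : g \in word_ball k ->
  exists s, [/\ (size s <= k)%N, all (fun a => a \in symset X) s & g = word_prod s].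
Proof.
elim: k g => [|k IH] g; first by rewrite inE => /eqP ->; exists [::].
case/word_ballS => a aG [h /IH[s [sk sX ->]] ->].
move: aG; rewrite in_setU1 => /orP[/eqP->|aX]; first by exists s; rewrite mul1mx leqW.
by exists (a :: s); rewrite /= aX.
Qed.

Lemma word_prod_ball s : all (fun a => a \in symset X) s -> word_prod s \in word_ball (size s).
Proof.
elim: s => [|a s IH]; first by rewrite inE.
by case/andP => aX sX; apply: (@word_ball_mul 1 (size s)); rewrite ?IH ?word_ball_gen.
Qed.

Hypothesis genX : generates_SL X.

Lemma symset_det a : a \in symset X -> \det a = 1.
Proof.
have XSL b : b \in X -> \det b = 1 by case: genX => /subsetP H _ /H; rewrite inE => /eqP.
rewrite inE => /orP[/XSL //|/XSL]; rewrite det_inv => /(congr1 GRing.inv).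
by rewrite invrK invr1.
Qed.

Lemma word_ball_det k g : g \in word_ball k -> \det g = 1.
Proof.
elim: k g => [|k IH] g; first by rewrite inE => /eqP ->; rewrite det1.
case/word_ballS => a aG [h /IH dh ->]; rewrite det_mulmx dh mulr1.
by move: aG; rewrite in_setU1 => /orP[/eqP->|/symset_det]; rewrite ?det1.
Qed.

Lemma det1_unit g : \det g = 1 -> g \in unitmx.
Proof. by rewrite unitmxE => ->; rewrite unitr1. Qed.

Lemma word_ball_unit k g : g \in word_ball k -> g \in unitmx.
Proof. by move/word_ball_det/det1_unit. Qed.

Lemma word_ball_inv k g : g \in word_ball k -> invmx g \in word_ball k.
Proof.
elim: k g => [|k IH] g; first by rewrite !inE => /eqP ->; rewrite invmx1.
case/word_ballS => a aG [h hB ->]; have uh := word_ball_unit hB.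
have aB : a \in word_ball 1.
  by move: aG; rewrite in_setU1 => /orP[/eqP->|/word_ball_gen]; rewrite ?word_ball1.
rewrite invmxM // ?(word_ball_unit aB) // -addn1 word_ball_mul ?IH //.
move: aG; rewrite in_setU1 => /orP[/eqP->|]; first by rewrite invmx1 word_ball1.
by rewrite inE => aX; apply: word_ball_gen; rewrite inE invmxK orbC.
Qed.

Lemma word_ball_conj k m g h : g \in word_ball k -> h \in word_ball m ->
  g *m h *m invmx g \in word_ball (k + m + k).
Proof. by move=> gB hB; rewrite !word_ball_mul ?word_ball_inv. Qed.

Lemma SL_word_ball g : \det g = 1 -> exists k, g \in word_ball k.
Proof.
move=> dg; case: genX => _ /(_ g); rewrite inE dg eqxx => /(_ isT)[s [sX ->]].
by exists (size s); apply: word_prod_ball.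
Qed.

(* The spans of the partial orbits of [u] increase strictly until they
   stabilise, so they do so after at most [dim U] steps. *)
Lemma short_word (U V : vectType F) (rho : 'M[F]_n -> 'End(U)) (u : U) (phi : 'Hom(U, V)) g :
  rho 1%:M u = u ->
  (forall a h, \det a = 1 -> \det h = 1 -> rho a (rho h u) = rho (a *m h) u) ->
  \det g = 1 -> phi (rho g u) != 0 ->
  exists2 w, w \in word_ball (dim U) & phi (rho w u) != 0.
Proof.
move=> rho1 rhoM dg phig.
pose W k := <<[seq rho w u | w <- enum (word_ball k)]>>%VS.
have inW k w : w \in word_ball k -> rho w u \in W k.
  by move=> wB; apply/memv_span/map_f; rewrite mem_enum.
have WS k : (W k <= W k.+1)%VS.
  apply/span_subvP => v /mapP[w]; rewrite mem_enum => wB ->.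
  by apply: inW; apply: word_ball_mono wB.
have [k kU Wk] : exists2 k, (k <= dim U)%N & (W k.+1 <= W k)%VS.
  have H m : (exists2 k, (k < m)%N & (W k.+1 <= W k)%VS) \/ (m <= \dim (W m))%N.
    elim: m => [|m [[k km Wk]|IH]]; first by right.
      by left; exists k => //; apply: ltnW.
    case: (boolP (W m.+1 <= W m)%VS) => Wm; first by left; exists m.
    right; apply: leq_ltn_trans IH _; rewrite ltn_neqAle dimvS // andbT.
    by rewrite (dimv_leqif_sup (WS m)).
  case: (H (dim U).+1) => [[k]|]; first by rewrite ltnS; exists k.
  by rewrite -dimvf leqNgt ltnS dimvS ?subvf.
have stable m w : w \in word_ball m -> rho w u \in W k.
  elim: m w => [|m IH] w.
    rewrite inE => /eqP ->; apply: inW; exact: word_ball1.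
  case/word_ballS => a aG [h hB ->].
  have aB : a \in word_ball 1.
    by move: aG; rewrite in_setU1 => /orP[/eqP->|/word_ball_gen]; rewrite ?word_ball1.
  rewrite -rhoM ?(word_ball_det aB) ?(word_ball_det hB) //.
  apply: (subvP Wk); apply: (subvP _ _ (memv_img (rho a) (IH _ hB))).
  rewrite limg_span; apply/span_subvP => v /mapP[v' /mapP[w' + ->] ->].
  rewrite mem_enum => w'B; rewrite rhoM ?(word_ball_det aB) ?(word_ball_det w'B) //.
  by apply: inW; rewrite -add1n word_ball_mul.
have [m gB] := SL_word_ball dg.
have [w /andP[wB wphi]|none] := pickP [pred w | (w \in word_ball k) && (phi (rho w u) != 0)].
  by exists w => //; apply: word_ball_mono wB.
case/negP: phig; rewrite -memv_ker; apply: (subvP _ _ (stable _ _ gB)).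
apply/span_subvP => v /mapP[w]; rewrite mem_enum memv_ker => wB ->.
by have := none w; rewrite /= wB => /negbFE.
Qed.

End Words.

(** * Transvections, their commutators and the choice of conjugates *)

Section Transvections.
Variables (F : fieldType) (n : nat).
Implicit Types (f g h u v z : 'cV[F]_n) (d e q : 'rV[F]_n) (a : F).

Definition tv f d : 'M[F]_n := 1%:M + f *m d.

Lemma tvDr f d d' : d *m f = 0 -> tv f d *m tv f d' = tv f (d + d').
Proof.
move=> df; rewrite /tv mulmxDl mul1mx !mulmxDr mulmx1 -mulmxA [d *m _]mulmxA df.
by rewrite mul0mx mulmx0 addr0 addrAC addrA.
Qed.

Lemma tvDl f f' d : d *m f' = 0 -> tv f d *m tv f' d = tv (f + f') d.
Proof.
move=> df; rewrite /tv mulmxDl mul1mx !mulmxDr !mulmxDl mulmx1 -mulmxA [d *m _]mulmxA df.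
by rewrite mul0mx mulmx0 addr0 addrAC addrA.
Qed.

Lemma tv0r f : tv f 0 = 1%:M. Proof. by rewrite /tv mulmx0 addr0. Qed.
Lemma tv0l d : tv 0 d = 1%:M. Proof. by rewrite /tv mul0mx addr0. Qed.

Lemma tvZ a f d : tv (a *: f) d = tv f (a *: d).
Proof. by rewrite /tv -scalemxAl -scalemxAr. Qed.

Lemma tv_mulN f d : d *m f = 0 -> tv f d *m tv f (- d) = 1%:M.
Proof. by move=> df; rewrite tvDr // subrr tv0r. Qed.

Lemma tv_unit f d : d *m f = 0 -> tv f d \in unitmx.
Proof. by move/tv_mulN/mulmx1_unit => []. Qed.

Lemma tv_inv f d : d *m f = 0 -> invmx (tv f d) = tv f (- d).
Proof.
move=> df; apply: (can_inj (mulKmx (tv_unit df))).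
by rewrite tv_mulN // mulmxV // tv_unit.
Qed.

Lemma tv_conj (x : 'M[F]_n) f d : x \in unitmx ->
  x *m tv f d *m invmx x = tv (x *m f) (d *m invmx x).
Proof. by move=> ux; rewrite /tv mulmxDr mulmx1 mulmxDl mulmxV // !mulmxA. Qed.

Lemma tv_mull m f d (B : 'M[F]_(n, m)) : tv f d *m B = B + f *m (d *m B).
Proof. by rewrite /tv mulmxDl mul1mx mulmxA. Qed.

Lemma tv_mulr f d e : e *m tv f d = e + (e *m f) *m d.
Proof. by rewrite /tv mulmxDr mulmx1 mulmxA. Qed.

(** Conjugation by [tv f d] fixes [e], as e f = 0, and moves [g] by a multiple of [f]; dividing by
    [tv g e] leaves that multiple. This brings a functional from a root at [g] to a root at [f]. *)
Lemma tv_commutator f d g e : d *m f = 0 -> e *m g = 0 -> e *m f = 0 ->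
  tv f d *m tv g e *m invmx (tv f d) *m invmx (tv g e) = tv f ((d *m g) *m e).
Proof.
move=> df eg ef; rewrite tv_conj ?tv_unit // tv_inv // tv_inv // [tv f d *m g]tv_mull tv_mulr ef.
have -> : tv g (- e) = tv (- g) e by rewrite /tv mulmxN mulNmx.
rewrite mul0mx addr0 tvDl; last by rewrite mulmxN eg oppr0.
by rewrite addrAC subrr add0r /tv !mulmxA.
Qed.

Lemma mul_mx11_row m (u : 'rV[F]_m) (c : 'M[F]_1) : c *m u = c 0 0 *: u.
Proof. by rewrite {1}[c]mx11_scalar mul_scalar_mx. Qed.

Lemma mx11_eq0 (c : 'M[F]_1) : (c == 0) = (c 0 0 == 0).
Proof.
apply/eqP/eqP => [->|c0]; first by rewrite mxE.
by apply/matrixP => i j; rewrite !ord1 c0 mxE.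
Qed.

(* Both sides are the determinant of the block matrix [[1, d], [- f, 1]]. *)
Lemma det_tv f d : \det (tv f d) = 1 + (d *m f) 0 0.
Proof.
pose B := block_mx (1%:M : 'M_1) d (- f) (1%:M : 'M_n).
have E1 : B = block_mx 1%:M 0 (- f) 1%:M *m block_mx 1%:M d 0 (tv f d).
  rewrite mulmx_block !mul1mx !mulmx1 !mul0mx !addr0 mulNmx /tv.
  by rewrite addrCA addNr addr0.
have E2 : B = block_mx 1%:M d 0 1%:M *m block_mx (1%:M + d *m f) 0 (- f) 1%:M.
  rewrite mulmx_block !mul1mx !mulmx1 !mul0mx !add0r mulmxN.
  by rewrite addrK.
have : \det B = \det B by [].
rewrite {1}E1 E2 !det_mulmx !det_lblock !det_ublock !det1 !mul1r !mulr1 => ->.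
by rewrite det_mx11 !mxE eqxx.
Qed.

Lemma det_tv1 f d : d *m f = 0 -> \det (tv f d) = 1.
Proof. by move=> df; rewrite det_tv df mxE addr0. Qed.

(** Some column of the cokernel of [B] detects [q]. *)
Lemma separate_row m (q : 'rV[F]_n) (B : 'M[F]_(m, n)) :
  ~~ (q <= B)%MS -> exists2 v : 'cV[F]_n, B *m v = 0 & q *m v != 0.
Proof.
rewrite submxE => /matrix0Pn[i [j]]; rewrite ord1 => H.
have colE p (C : 'M[F]_(p, n)) : C *m col j (cokermx B) = col j (C *m cokermx B).
  by rewrite !colE mulmxA.
exists (col j (cokermx B)); rewrite colE.
  by rewrite mulmx_coker; apply/matrixP => x y; rewrite !mxE.
by apply: contraNneq H => /matrixP/(_ 0 0); rewrite !mxE => ->.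
Qed.

Lemma separate_col m (f : 'cV[F]_n) (B : 'M[F]_(n, m)) :
  ~~ (f^T <= B^T)%MS -> exists2 q : 'rV[F]_n, q *m B = 0 & q *m f != 0.
Proof.
case/separate_row => v Bv fv; exists v^T.
  by apply: trmx_inj; rewrite trmx_mul trmxK Bv trmx0.
by apply: contraNneq fv => E; apply/eqP; apply: trmx_inj; rewrite trmx_mul trmxK E trmx0.
Qed.

Lemma separate_one f g : (forall a, f != a *: g) ->
  exists2 q : 'rV[F]_n, q *m g = 0 & q *m f != 0.
Proof.
move=> ind; apply: separate_col; apply/negP => /sub_rVP[a] E.
by case/eqP: (ind a); apply: trmx_inj; rewrite linearZ.
Qed.

Lemma separate_two f g h : (forall a b, f != a *: g + b *: h) ->
  exists q : 'rV[F]_n, [/\ q *m g = 0, q *m h = 0 & q *m f != 0].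
Proof.
move=> ind; have [|q] := @separate_col _ f (row_mx g h).
  rewrite tr_row_mx -addsmxE; apply/negP => /sub_addsmxP[[x y]] /= E.
  case/eqP: (ind (x 0 0) (y 0 0)); apply: trmx_inj.
  by rewrite E !mul_mx11_row linearD !linearZ.
rewrite mul_mx_row => E qf; exists q; split=> //.
  by rewrite -[LHS](@row_mxKl _ _ _ _ _ (q *m h)) E linear0.
by rewrite -[LHS](@row_mxKr _ _ _ _ (q *m g)) E linear0.
Qed.

Lemma vanishing_col d e : (2 < n)%N -> exists z, [/\ z != 0, d *m z = 0 & e *m z = 0].
Proof.
move=> n3; have : cokermx (col_mx d e) != 0.
  rewrite -mxrank_eq0 mxrank_coker subn_eq0 -ltnNge (leq_ltn_trans _ n3) //.
  exact: rank_leq_row.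
case/matrix0Pn => i [j Hij]; exists (col j (cokermx (col_mx d e))).
have E : col_mx d e *m col j (cokermx (col_mx d e)) = 0.
  by rewrite colE mulmxA mulmx_coker mul0mx.
rewrite mul_col_mx in E; split.
- by apply: contraNneq Hij => /matrixP/(_ i 0); rewrite !mxE => ->.
- by rewrite -[LHS](@col_mxKu _ _ _ _ _ (e *m col j (cokermx (col_mx d e)))) E linear0.
- by rewrite -[LHS](@col_mxKd _ _ _ _ (d *m col j (cokermx (col_mx d e)))) E linear0.
Qed.

(** Take d u != 0, q u = 0 and q f != 0. The transvection 1 + u q sends f to f + u (q f), and its
    inverse sends d to d - (d u) q; both values are (d u)(q f) up to sign. *)
Lemma exists_opposite_conj f d : d != 0 -> f != 0 -> d *m f = 0 ->
  exists w, [/\ \det w = 1, d *m (w *m f) != 0 & d *m invmx w *m f != 0].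
Proof.
move=> d0 f0 df.
have [i [j dj]] : exists i j, d i j != 0 by apply/matrix0Pn.
rewrite ord1 in dj.
pose u : 'cV[F]_n := delta_mx j 0.
have du : d *m u != 0.
  by rewrite mx11_eq0 -colE mxE.
have [a|q qu qf] := @separate_one f u.
  apply: contraNneq f0 => E; move: df; rewrite E -scalemxAr => /eqP.
  by rewrite scaler_eq0 (negPf du) orbF => /eqP ->; rewrite scale0r.
exists (tv u q); rewrite det_tv1 // tv_inv // tv_mull mulmxDr df add0r.
rewrite tv_mulr mulmxDl df add0r !mulmxA mulmxN mulNmx oppr_eq0.
have E : d *m u *m q *m f != 0.
  by rewrite -mulmxA mul_mx11_row scaler_eq0 negb_or -mx11_eq0 du.
by [].
Qed.

(* The vanishing of this cyclic expression for all conjugates [(h, k)] is what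
   distinguishes symplectic groups. *)
Lemma exists_nonsymplectic_conj f d g e : (2 < n)%N ->
  d *m f = 0 -> e *m g = 0 -> d *m g != 0 -> e *m f != 0 ->
  exists w, \det w = 1 /\
    d *m invmx w *m ((e *m f) 0 0 *: (g *m d) + (d *m g) 0 0 *: (f *m e)) *m (w *m f) != 0.
Proof.
move=> n3 df eg dg ef; set a := (e *m f) 0 0; set b := (d *m g) 0 0.
have a0 : a != 0 by rewrite -mx11_eq0.
have b0 : b != 0 by rewrite -mx11_eq0.
have efE : e *m f = a%:M by rewrite [LHS]mx11_scalar.
have dgE : d *m g = b%:M by rewrite [LHS]mx11_scalar.
have [z [z0 dz ez]] := vanishing_col d e n3.
have [x y|q [qf qg qz]] := @separate_two z f g.
  apply: contraNneq z0 => E.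
  have : y *: (d *m g) == 0 by rewrite -dz E mulmxDr -!scalemxAr df scaler0 add0r.
  have : x *: (e *m f) == 0 by rewrite -ez E mulmxDr -!scalemxAr eg scaler0 addr0.
  rewrite !scaler_eq0 (negPf dg) (negPf ef) !orbF => /eqP x0 /eqP y0.
  by rewrite E x0 y0 !scale0r addr0.
have ezE : e *m (a^-1 *: z) = 0 by rewrite -scalemxAr ez scaler0.
have qgE : (b^-1 *: q) *m g = 0 by rewrite -scalemxAl qg scaler0.
have e'z : (a^-1 *: e) *m z = 0 by rewrite -scalemxAl ez scaler0.
have qb : (- (b^-1 *: q)) *m g = 0 by rewrite mulNmx qgE oppr0.
(* This element sends f to f + z and turns d into d + q - (q z / a) e. The matrix in the goal maps f
   + z to b a f, so the value is - b a (q z). *)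
exists (tv z (a^-1 *: e) *m tv g (- (b^-1 *: q))); split.
  by rewrite det_mulmx !det_tv1 // mulr1.
rewrite invmxM ?tv_unit // !tv_inv // opprK.
have -> : tv z (a^-1 *: e) *m tv g (- (b^-1 *: q)) *m f = f + z.
  have E1 : tv g (- (b^-1 *: q)) *m f = f.
    by rewrite tv_mull mulNmx -scalemxAl qf scaler0 oppr0 mulmx0 addr0.
  rewrite -mulmxA E1 tv_mull -scalemxAl efE.
  by rewrite scale_scalar_mx mulVf // mulmx1.
have -> : d *m (tv g (b^-1 *: q) *m tv z (- (a^-1 *: e)))
          = d + q - ((q *m z) 0 0 / a) *: e.
  have E2 : d *m tv g (b^-1 *: q) = d + q.
    by rewrite tv_mulr dgE mul_scalar_mx scalerA mulfV // scale1r.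
  rewrite mulmxA E2 tv_mulr mulmxDl dz add0r.
  by rewrite mul_mx11_row scalerN scalerA.
have Mh : (a *: (g *m d) + b *: (f *m e)) *m (f + z) = (b * a) *: f.
  rewrite mulmxDl -!scalemxAl -!mulmxA !mulmxDr df dz ez !mulmx0 !addr0 scaler0 add0r.
  by rewrite efE mul_mx_scalar scalerA.
rewrite -mulmxA Mh -scalemxAr scaler_eq0 mulf_eq0 (negPf a0) (negPf b0) /=.
rewrite !mulmxDl df add0r qf add0r mulNmx -scalemxAl efE scale_scalar_mx divfK //.
by rewrite oppr_eq0 -[X in X%:M]/((q *m z) 0 0) -mx11_scalar.
Qed.

Lemma row_free_three (x y z : 'rV[F]_n) :
  (forall a b c, a *: x + b *: y + c *: z = 0 -> [/\ a = 0, b = 0 & c = 0]) ->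
  row_free (col_mx (col_mx x y) z).
Proof.
move=> ind; apply: inj_row_free => v.
rewrite -[v]hsubmxK -[lsubmx v]hsubmxK !mul_row_col !mul_mx11_row => /ind[a0 b0 c0].
have z0 (c : 'M[F]_1) : c 0 0 = 0 -> c = 0 by move=> E; apply/eqP; rewrite mx11_eq0 E.
by rewrite (z0 _ a0) (z0 _ b0) (z0 _ c0) !row_mx0.
Qed.

(** Any invertible [G] extending the map is corrected by a matrix [D] that fixes x' and y' and
    scales z' by 1 / det G; hence the factor c on the third vector. *)
Lemma SL_three (x y z x' y' z' : 'rV[F]_n) :
  row_free (col_mx (col_mx x y) z) -> row_free (col_mx (col_mx x' y') z') ->
  exists G c, [/\ \det G = 1, c != 0, x *m G = x', y *m G = y' & z *m G = c *: z'].
Proof.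
set A := col_mx _ z; set B := col_mx _ z' => Afree Bfree.
have AU : A *m (pinvmx A *m B) = B by rewrite mulmxA mulmxVp // mul1mx.
have [|G uG] := @complete_unitmx _ _ _ A (pinvmx A *m B).
  by rewrite AU; move: Afree Bfree; rewrite /row_free => /eqP -> /eqP ->.
rewrite AU /A /B !mul_col_mx => /eq_col_mx[/eq_col_mx[Gx Gy] Gz].
have [k [kx ky kz]] : exists k : 'cV[F]_n, [/\ x' *m k = 0, y' *m k = 0 & z' *m k != 0].
  case: (@separate_row _ z' (col_mx x' y')) => [|k].
    apply/negP => /submxP[D] E.
    have : row_mx D (- 1%:M) *m B = 0 by rewrite mul_row_col -E mulNmx mul1mx subrr.
    rewrite -(mul0mx _ B) => /(row_free_inj Bfree)/(congr1 rsubmx).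
    rewrite row_mxKr linear0 => /eqP; rewrite oppr_eq0 => /eqP/matrixP/(_ 0 0).
    by rewrite !mxE => /eqP; rewrite oner_eq0.
  rewrite mul_col_mx => E kz; exists k; split=> //.
    by rewrite -[LHS](@col_mxKu _ _ _ _ _ (y' *m k)) E linear0.
  by rewrite -[LHS](@col_mxKd _ _ _ _ (x' *m k)) E linear0.
pose l := (z' *m k) 0 0; have l0 : l != 0 by rewrite -mx11_eq0.
have dG : \det G != 0 by rewrite -unitfE -unitmxE.
pose c := (\det G)^-1; pose D := tv k (((c - 1) / l) *: z').
exists (G *m D), c; rewrite !mulmxA -Gx -Gy -Gz; split.
- rewrite det_mulmx det_tv -scalemxAl mxE divfK // addrC subrK /c mulfV //.
- by rewrite invr_eq0.
- by rewrite tv_mulr kx mul0mx addr0.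
- by rewrite tv_mulr ky mul0mx addr0.
- rewrite tv_mulr mul_mx11_row -/l scalerA mulrC divfK // scalerBl scale1r.
  by rewrite addrC subrK.
Qed.

Lemma separate_row_one q q' : (forall a, q != a *: q') ->
  exists2 v : 'cV[F]_n, q' *m v = 0 & q *m v != 0.
Proof. by move=> ind; apply: separate_row; apply/negP => /sub_rVP[a /eqP]; apply/negP. Qed.

(** Choose a, b with q2 a = q1 b = 0 and q1 a, q2 b nonzero, and y outside the plane of f and v with
    q y != 0. The inverse of w is made to send f, v, y to a, b, c f. Then w f is a multiple of y,
    and the alternating form takes the value (q1 a)(q2 b). *)
Lemma exists_pair_conj q1 q2 f v :
  (forall a, q1 != a *: q2) -> (forall a, q2 != a *: q1) ->
  q1 *m f = 0 -> q2 *m f = 0 -> f != 0 -> (forall a, v != a *: f) ->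
  exists w q, [/\ \det w = 1, q = q1 \/ q = q2, q *m (w *m f) != 0 &
    f^T *m ((invmx w)^T *m (q1^T *m q2 - q2^T *m q1) *m invmx w) *m v != 0].
Proof.
move=> q12 q21 q1f q2f f0 vf.
have [a q2a q1a] := separate_row_one q12.
have [b q1b q2b] := separate_row_one q21.
have fsep s : q1 *m (s *: f) = 0 /\ q2 *m (s *: f) = 0.
  by rewrite -!scalemxAr q1f q2f scaler0.
have plane y : (y^T <= col_mx f^T v^T)%MS -> exists s t, y = s *: f + t *: v.
  rewrite -addsmxE => /sub_addsmxP[[s t]] /= E; exists (s 0 0), (t 0 0); apply: trmx_inj.
  by rewrite E !mul_mx11_row linearD !linearZ.
(* [a] and [b] do not both lie in the plane spanned by [f] and [v]. *)
have [y [q [yfv qq qy]]] : exists (y : 'cV[F]_n) (q : 'rV[F]_n),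
    [/\ ~~ (y^T <= col_mx f^T v^T)%MS, q = q1 \/ q = q2 & q *m y != 0].
  case aP: (a^T <= col_mx f^T v^T)%MS; last first.
    by exists a, q1; split; rewrite ?aP //; left.
  case bP: (b^T <= col_mx f^T v^T)%MS; last first.
    by exists b, q2; split; rewrite ?bP //; right.
  exfalso; have [s [t aE]] := plane _ aP; have [s' [t' bE]] := plane _ bP.
  move: q2a q1a q1b q2b; rewrite aE bE !mulmxDr !(fsep _).1 !(fsep _).2 !add0r -!scalemxAr.
  move=> /eqP; rewrite !scaler_eq0 !negb_or => /orP[/eqP->|/eqP q2v]; first by rewrite eqxx.
  by move=> _ _; rewrite q2v eqxx andbF.
have free1 : row_free (col_mx (col_mx f^T v^T) y^T).
  apply: row_free_three => s t c E.
  have c0 : c = 0.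
    apply: contraNeq yfv => c0.
    have -> : y^T = row_mx (- (s / c))%:M (- (t / c))%:M *m col_mx f^T v^T.
      rewrite mul_row_col !mul_scalar_mx; apply: (scalerI c0).
      rewrite scalerDr !scalerA !mulrN !(mulrC c) !divfK // !scaleNr.
      by apply/eqP; rewrite -opprD -addr_eq0 addrC E.
    exact: submxMl.
  move: E; rewrite c0 scale0r addr0 => E.
  have t0 : t = 0.
    apply/eqP; apply: contraT => t0; case/eqP: (vf (- (s / t))).
    apply: trmx_inj; rewrite linearZ /=; apply: (scalerI t0).
    rewrite scalerA mulrN mulrC divfK // scaleNr; apply/eqP.
    by rewrite -addr_eq0 addrC E.
  move: E; rewrite t0 scale0r addr0 => /eqP; rewrite scaler_eq0 => /orP[/eqP->//|].
  by move/eqP/(congr1 trmx); rewrite trmxK trmx0 => /eqP; rewrite (negPf f0).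
have free2 : row_free (col_mx (col_mx a^T b^T) f^T).
  apply: row_free_three => s t c E.
  have {}E : s *: a + t *: b + c *: f = 0.
    by apply: trmx_inj; rewrite !linearD !linearZ /= E trmx0.
  have s0 : s = 0.
    have /eqP : q1 *m (s *: a + t *: b + c *: f) = 0 by rewrite E mulmx0.
    rewrite !mulmxDr (fsep _).1 addr0 -!scalemxAr q1b scaler0 addr0 scaler_eq0 (negPf q1a).
    by rewrite orbF => /eqP.
  have t0 : t = 0.
    have /eqP : q2 *m (s *: a + t *: b + c *: f) = 0 by rewrite E mulmx0.
    rewrite !mulmxDr (fsep _).2 addr0 -!scalemxAr q2a scaler0 add0r scaler_eq0 (negPf q2b).
    by rewrite orbF => /eqP.
  split=> //; move: E; rewrite s0 t0 !scale0r !add0r => /eqP; rewrite scaler_eq0 (negPf f0) orbF.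
  by move/eqP.
have [G [c [dG c0 Gf Gv Gy]]] := SL_three free1 free2.
have dGt : \det G^T = 1 by rewrite det_tr.
have uG : G^T \in unitmx by rewrite unitmxE dGt unitr1.
have GfE : G^T *m f = a by apply: trmx_inj; rewrite trmx_mul trmxK Gf.
have GvE : G^T *m v = b by apply: trmx_inj; rewrite trmx_mul trmxK Gv.
have GyE : G^T *m y = c *: f by apply: trmx_inj; rewrite trmx_mul trmxK Gy linearZ.
exists (invmx G^T), q; split=> //.
- by rewrite det_inv dGt invr1.
- have -> : invmx G^T *m f = c^-1 *: y.
    by apply: (can_inj (mulKmx uG)); rewrite mulKVmx // -scalemxAr GyE scalerA mulVf // scale1r.
  by rewrite -scalemxAr scaler_eq0 invr_eq0 (negPf c0).
rewrite invmxK trmxK !mulmxA Gf -!mulmxA GvE.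
have -> : a^T *m ((q1^T *m q2 - q2^T *m q1) *m b) = (q1 *m a)^T *m (q2 *m b).
  by rewrite mulmxBl mulmxBr -!mulmxA q1b !mulmx0 subr0 trmx_mul mulmxA.
rewrite mul_mx11_row scaler_eq0 (negPf q2b) orbF mxE.
by rewrite -mx11_eq0.
Qed.

End Transvections.

(** * Copies of SL_2 acting on a plane *)

Section Embedding.
Variables (F : fieldType) (n : nat).
Variables (f g : 'cV[F]_n) (d e : 'rV[F]_n) (a b : F).
Hypotheses (df : d *m f = 0) (eg : e *m g = 0).
Hypotheses (dg : d *m g = a%:M) (ef : e *m f = b%:M) (a0 : a != 0) (b0 : b != 0).

(* The 2x2 matrix [[x, y], [z, t]] acts on the plane spanned by [f], [g] and
   fixes the intersection of the kernels of [d] and [e]. *)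
Definition plane_embed (x y z t : F) : 'M[F]_n :=
  1%:M + f *m ((y / a) *: d + ((x - 1) / b) *: e)
       + g *m (((t - 1) / a) *: d + (z / b) *: e).

Lemma plane_embedM x y z t x' y' z' t' :
  plane_embed x y z t *m plane_embed x' y' z' t' =
  plane_embed (x * x' + y * z') (x * y' + y * t') (z * x' + t * z') (z * y' + t * t').
Proof.
have prod (r1 r2 s1 s2 : 'rV[F]_n) c1 c2 c3 c4 :
   r1 *m f = c1%:M -> r1 *m g = c2%:M -> r2 *m f = c3%:M -> r2 *m g = c4%:M ->
   (1%:M + f *m r1 + g *m r2) *m (1%:M + f *m s1 + g *m s2) =
   1%:M + f *m (r1 + s1 + c1 *: s1 + c2 *: s2) + g *m (r2 + s2 + c3 *: s1 + c4 *: s2).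
  move=> r1f r1g r2f r2g; rewrite !mulmxDl !mulmxDr !mul1mx !mulmx1.
  have E (p q : 'cV[F]_n) (r s : 'rV[F]_n) c : r *m q = c%:M -> p *m r *m (q *m s) = p *m (c *: s).
    by move=> rq; rewrite -mulmxA [r *m _]mulmxA rq mul_scalar_mx.
  rewrite (E _ _ _ _ _ r1f) (E _ _ _ _ _ r1g) (E _ _ _ _ _ r2f) (E _ _ _ _ _ r2g).
  move: (f *m r1) (f *m s1) (f *m (c1 *: s1)) (f *m (c2 *: s2)) => A1 A2 A3 A4.
  move: (g *m r2) (g *m s2) (g *m (c3 *: s1)) (g *m (c4 *: s2)) => B1 B2 B3 B4.
  by apply/matrixP => i j; rewrite !mxE; ring.
rewrite /plane_embed; set r1 := _ *: d + _; set r2 := _ *: d + _.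
set s1 := _ *: d + _; set s2 := _ *: d + _.
have r1f : r1 *m f = (x - 1)%:M.
  by rewrite mulmxDl -!scalemxAl df ef scaler0 add0r scale_scalar_mx divfK.
have r1g : r1 *m g = y%:M.
  by rewrite mulmxDl -!scalemxAl eg dg scaler0 addr0 scale_scalar_mx divfK.
have r2f : r2 *m f = z%:M.
  by rewrite mulmxDl -!scalemxAl df ef scaler0 add0r scale_scalar_mx divfK.
have r2g : r2 *m g = (t - 1)%:M.
  by rewrite mulmxDl -!scalemxAl eg dg scaler0 addr0 scale_scalar_mx divfK.
rewrite (prod _ _ _ _ _ _ _ _ r1f r1g r2f r2g).
congr (_ + _ + _); congr (_ *m _); apply/rowP => i; rewrite !mxE; field; by rewrite a0 b0.
Qed.

Lemma plane_embed_upper : plane_embed 1 a 0 1 = tv f d.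
Proof.
by rewrite /plane_embed subrr !mul0r !scale0r addr0 add0r mulmx0 addr0 divff // scale1r.
Qed.

Lemma plane_embed_lower : plane_embed 1 0 b 1 = tv g e.
Proof.
by rewrite /plane_embed subrr !mul0r !scale0r addr0 add0r mulmx0 addr0 divff // scale1r.
Qed.

End Embedding.

Section EmbeddedWords.
Variables (F : finFieldType) (n : nat) (X : {set 'M[F]_n}).
Hypothesis genX : generates_SL X.
Variables (f g : 'cV[F]_n) (d e : 'rV[F]_n) (a b : F).
Hypotheses (df : d *m f = 0) (eg : e *m g = 0).
Hypotheses (dg : d *m g = a%:M) (ef : e *m f = b%:M) (a0 : a != 0) (b0 : b != 0).

(** The homomorphism [phi] sends [upper a] and [lower b] to the two given transvections and
    [upper (x * a)] to [tv f (x *: d)]; each letter costs m. *)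
Lemma root_group_ball m k :
  tv f d \in word_ball X m -> tv g e \in word_ball X m ->
  (forall x, upper x \in ball a b k) ->
  forall x, tv f (x *: d) \in word_ball X (k * m).
Proof.
move=> tm sm up_k x.
pose phi (u : mat2 F) := plane_embed f g d e a b (e11 u) (e12 u) (e21 u) (e22 u).
have phiM u v : phi (mul2 u v) = phi u *m phi v by rewrite plane_embedM.
have phi1 : phi one2 = 1%:M.
  by rewrite /phi /plane_embed /one2 /e11 /e12 /e21 /e22 /= subrr !mul0r !scale0r !addr0 !mulmx0 !addr0.
have phiV u : det2 u = 1 -> phi (adj2 u) = invmx (phi u).
  move=> du; have uu : phi u *m phi (adj2 u) = 1%:M by rewrite -phiM mul2V.
  have [uphi _] := mulmx1_unit uu.
  by apply: (can_inj (mulKmx uphi)); rewrite uu mulmxV.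
have phi_up : phi (upper a) = tv f d by apply: plane_embed_upper.
have phi_low : phi (lower b) = tv g e by apply: plane_embed_lower.
have phi_gens u : u \in gens2 a b -> phi u \in word_ball X m.
  rewrite !inE -!orbA => /or4P[/eqP->|/eqP->|/eqP->|/orP[]/eqP->].
  - by rewrite phi1 word_ball1.
  - by rewrite phi_up.
  - by rewrite -adj_up phiV ?det2_up // phi_up (word_ball_inv genX).
  - by rewrite phi_low.
  - by rewrite -adj_low phiV ?det2_low // phi_low (word_ball_inv genX).
have phi_ball r u : u \in ball a b r -> phi u \in word_ball X (r * m).
  elim: r u => [|r IH] u; first by rewrite inE => /eqP ->; rewrite phi1 word_ball1.
  by case/ballS => v vG [w wB ->]; rewrite phiM mulSn word_ball_mul ?phi_gens ?IH.
have := phi_ball _ _ (up_k (x * a)).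
rewrite /phi /plane_embed /upper /e11 /e12 /e21 /e22 /= subrr !mul0r !scale0r !addr0 mulmx0 addr0.
by rewrite mulfK.
Qed.

End EmbeddedWords.

(** * The root group of the transvection and a pencil of functionals *)

Section RootGroups.
Variables (F : finFieldType) (n : nat) (X : {set 'M[F]_n}).
Hypotheses (n3 : (2 < n)%N) (genX : generates_SL X).
Variables (f : 'cV[F]_n) (d : 'rV[F]_n).
Hypotheses (f0 : f != 0) (d0 : d != 0) (df : d *m f = 0) (tX : tv f d \in X).
Variable K : nat.
Hypothesis sl2K : forall a b : F, a != 0 -> b != 0 -> forall x, upper x \in ball a b K.
Local Notation wb := (word_ball X).
Implicit Types (w : 'M[F]_n) (g h : 'cV[F]_n) (e q : 'rV[F]_n) (k l : nat).

Definition conj_rep w : 'End('M[F]_n) := linfun (mulmxr (invmx w) \o mulmx w).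

Lemma conj_repE w A : conj_rep w A = w *m A *m invmx w.
Proof. by rewrite lfunE. Qed.

(** The pair (w f, d w^-1) is encoded by its rank one product, a point of a representation of
    dimension n^2. Conditions bilinear in the pair become linear, so [short_word] applies. *)
Lemma short_conj (phi : 'Hom('M[F]_n, 'M[F]_1)) w :
  \det w = 1 -> phi ((w *m f) *m (d *m invmx w)) != 0 ->
  exists2 w', w' \in wb (n * n) & phi ((w' *m f) *m (d *m invmx w')) != 0.
Proof.
move=> dw; have E v : (v *m f) *m (d *m invmx v) = conj_rep v (f *m d).
  by rewrite conj_repE !mulmxA.
rewrite E => phiw; have [||w'] := short_word genX _ _ dw phiw.
- by rewrite conj_repE invmx1 mul1mx mulmx1.
- by move=> a h /det1_unit ua /det1_unit uh; rewrite !conj_repE invmxM // !mulmxA.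
by rewrite dim_matrix => w'B phiw'; exists w'; rewrite ?E.
Qed.

Lemma conj_transvection w k e : e *m f = 0 -> w \in wb k -> 
  w *m tv f e *m invmx w = tv (w *m f) (e *m invmx w).
Proof. by move=> ef wB; rewrite tv_conj ?(word_ball_unit genX wB). Qed.

Lemma conj_vanish w k e : w \in wb k -> e *m f = 0 -> (e *m invmx w) *m (w *m f) = 0.
Proof. by move=> wB ef; rewrite mulmxA mulmxKV ?(word_ball_unit genX wB). Qed.

Lemma conj_ball w k l e : e *m f = 0 -> w \in wb k -> tv f e \in wb l ->
  tv (w *m f) (e *m invmx w) \in wb (k + l + k).
Proof.
by move=> ef wB tB; rewrite -(conj_transvection ef wB) (word_ball_conj genX).
Qed.

Lemma transvection_ball : tv f d \in wb 1.
Proof. by apply: word_ball_gen; rewrite inE tX. Qed.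

(** K letters, each a transvection conjugated by a word of length at most n^2. *)
Definition root_cost := (K * (n * n + 1 + n * n))%N.

(** The two conditions d g != 0 and e f != 0 are merged into (d g)(e f) != 0, which is linear in the
    product g e. *)
Lemma exists_partner : exists g e,
  [/\ e *m g = 0, d *m g != 0, e *m f != 0,
   forall x, tv f (x *: d) \in wb root_cost &
   forall x, tv g (x *: e) \in wb (n * n + root_cost + n * n)].
Proof.
have [w [dw dwf dwf']] := exists_opposite_conj d0 f0 df.
pose phi : 'Hom('M[F]_n, 'M[F]_1) := linfun (mulmxr f \o mulmx d).
have phiE g e : phi (g *m e) = (d *m g) *m (e *m f) by rewrite lfunE /= !mulmxA.
have nz2 (c c' : 'M[F]_1) : (c *m c' != 0) = (c != 0) && (c' != 0).
  by rewrite mul_mx11_row scaler_eq0 negb_or !mx11_eq0.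
have [|w' w'B] := @short_conj phi w dw; first by rewrite phiE nz2 dwf.
rewrite phiE nz2 => /andP[dg ef].
set g := w' *m f in dg; set e := d *m invmx w' in ef.
have eg : e *m g = 0 := conj_vanish w'B df.
have sB := conj_ball df w'B transvection_ball.
have tB : tv f d \in wb (n * n + 1 + n * n).
  by apply: word_ball_mono transvection_ball; lia.
have a0 : (d *m g) 0 0 != 0 by rewrite -mx11_eq0.
have b0 : (e *m f) 0 0 != 0 by rewrite -mx11_eq0.
have root x : tv f (x *: d) \in wb root_cost.
  exact: (root_group_ball genX df eg (mx11_scalar _) (mx11_scalar _) a0 b0 tB sB (sl2K a0 b0)).
exists g, e; split=> // x; have xdf : (x *: d) *m f = 0 by rewrite -scalemxAl df scaler0.
by have := conj_ball xdf w'B (root x); rewrite -scalemxAl.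
Qed.

(** The first summand pays for the multiple of d, the rest for a commutator whose second entry is a
    root at h conjugated by the inverse of s. *)
Definition pencil_cost := (root_cost + (root_cost + root_cost + 2 * (3 * (n * n + root_cost + n * n) + 2 * root_cost)))%N.

(** For a short conjugate root (h, k) with nonvanishing cyclic expression, an element s of the SL_2
    on the plane of f and g is found such that q = k s kills f while h' = s^-1 h satisfies d h' !=
    0. The commutator of [tv f d] with the root (h', q) then lies at f along q. As q h' = 0, the
    functionals q and d are independent. *)
Lemma exists_pencil : exists q : 'rV[F]_n,
  [/\ q *m f = 0, (forall a, d != a *: q), (forall a, q != a *: d) &
   forall x y, tv f (x *: d + y *: q) \in wb pencil_cost].
Proof.
have [g [e [eg dg ef rootf rootg]]] := exists_partner.
pose a : F := (e *m f) 0 0; pose b : F := (d *m g) 0 0.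
have a0 : a != 0 by rewrite -mx11_eq0.
have b0 : b != 0 by rewrite -mx11_eq0.
have efE : e *m f = a%:M by rewrite [LHS]mx11_scalar.
have dgE : d *m g = b%:M by rewrite [LHS]mx11_scalar.
have [w [dw Hw]] := exists_nonsymplectic_conj n3 df eg dg ef.
pose M : 'M[F]_n := a *: (g *m d) + b *: (f *m e).
(* The trace pairing with [M]: on h r it takes the value r M h. *)
pose phi : 'Hom('M[F]_n, 'M[F]_1) := linfun (mulmxr (mxvec M^T)^T \o mxvec).
have phiE h (r : 'rV[F]_n) : (phi (h *m r) != 0) = (r *m M *m h != 0).
  rewrite lfunE /= -[h in LHS]trmxK mxvec_dotmul -!trmx_mul mulmxA.
  by rewrite !mx11_eq0 mxE.
have [|w' w'B] := @short_conj phi w dw; first by rewrite phiE.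
rewrite phiE; set h := w' *m f; set k := d *m invmx w' => kMh.
have kh : k *m h = 0 := conj_vanish w'B df.
have roothk x : tv h (x *: k) \in wb (n * n + root_cost + n * n).
  have xdf : (x *: d) *m f = 0 by rewrite -scalemxAl df scaler0.
  by have := conj_ball xdf w'B (rootf x); rewrite -scalemxAl.
have MhE : k *m M *m h = (a * (k *m g) 0 0 * (d *m h) 0 0 + b * (k *m f) 0 0 * (e *m h) 0 0)%:M.
  have -> : k *m M *m h = a *: ((k *m g) *m (d *m h)) + b *: ((k *m f) *m (e *m h)).
    by rewrite /M mulmxDr mulmxDl -!scalemxAr -!scalemxAl !mulmxA.
  move: (k *m g) (d *m h) (k *m f) (e *m h) => c1 c2 c3 c4.
  rewrite !mul_mx11_row; apply/matrixP => i j.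
  by rewrite !ord1 !mxE eqxx mulr1n !mulrA.
pose kg := (k *m g) 0 0; pose kf := (k *m f) 0 0.
pose dh := (d *m h) 0 0; pose eh := (e *m h) 0 0.
have kgE : k *m g = kg%:M by rewrite [LHS]mx11_scalar.
have kfE : k *m f = kf%:M by rewrite [LHS]mx11_scalar.
have dhE : d *m h = dh%:M by rewrite [LHS]mx11_scalar.
have ehE : e *m h = eh%:M by rewrite [LHS]mx11_scalar.
have nz : a * kg * dh + b * kf * eh != 0.
  by move: kMh; rewrite MhE mx11_eq0 mxE eqxx mulr1n.
have scalar_neq0 (c : F) : (c%:M != 0 :> 'M_1) = (c != 0).
  by rewrite mx11_eq0 mxE eqxx mulr1n.
have egx x : (x *: e) *m g = 0 by rewrite -scalemxAl eg scaler0.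
have dfx x : (x *: d) *m f = 0 by rewrite -scalemxAl df scaler0.
(* [s] moves [f] to the kernel of [k] on the plane of [f] and [g]. *)
have [s [sB ksf dsh]] : exists s : 'M[F]_n,
   [/\ s \in wb (root_cost + (n * n + root_cost + n * n)),
     k *m (s *m f) = 0 & d *m (invmx s *m h) != 0].
  have [kg0|kg0] := eqVneq kg 0.
    (* If k kills g, this s sends f to g and d s^-1 is - (b / a) e. The cyclic expression reduces to
       b (k f)(e h), so e h != 0. *)
    exists (tv f (- b^-1 *: d) *m tv g (a^-1 *: e)).
    rewrite word_ball_mul ?rootf ?rootg ?invmxM ?tv_unit ?tv_inv //.
    have sf : tv f (- b^-1 *: d) *m tv g (a^-1 *: e) *m f = g.
      have E1 : tv g (a^-1 *: e) *m f = f + g.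
        by rewrite tv_mull -scalemxAl efE scale_scalar_mx mulVf // mulmx1.
      rewrite -mulmxA E1 tv_mull -scalemxAl mulmxDr df add0r dgE scale_scalar_mx.
      by rewrite mulNr mulVf // mul_mx_scalar scaleN1r addrC addKr.
    have ds : d *m (tv g (- (a^-1 *: e)) *m tv f (- (- b^-1 *: d))) = - (b / a) *: e.
      have E1 : d *m tv g (- (a^-1 *: e)) = d - (b / a) *: e.
        by rewrite tv_mulr dgE mul_scalar_mx scalerN scalerA.
      rewrite mulmxA E1 tv_mulr mulmxBl df sub0r -scalemxAl efE scale_scalar_mx divfK //.
      rewrite scaleNr opprK mulNmx mul_scalar_mx scalerA mulfV // scale1r.
      by rewrite addrAC subrr add0r scaleNr.
    split=> //; first by rewrite sf kgE kg0 raddf0.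
    rewrite mulmxA ds -scalemxAl ehE scale_scalar_mx scalar_neq0.
    have eh0 : eh != 0 by apply: contraNneq nz => ->; rewrite kg0 !mulr0 mul0r addr0.
    by rewrite mulf_neq0 // oppr_eq0 mulf_neq0 ?invr_eq0.
  (* The transvection at g along l e sends f to f + l a g; this l makes k vanish there, and d s^-1 h
     becomes the cyclic expression divided by a (k g). *)
  pose l := - (kf / kg / a).
  exists (tv g (l *: e)); rewrite tv_inv //; split.
  - by apply: word_ball_mono (rootg l); rewrite leq_addl.
  - rewrite tv_mull -scalemxAl efE scale_scalar_mx /l mulNr divfK // mul_mx_scalar scaleNr.
    rewrite mulmxBr kfE -scalemxAr kgE scale_scalar_mx divfK // subrr //.
  rewrite tv_mull mulNmx -scalemxAl ehE scale_scalar_mx mulmxN mul_mx_scalar.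
  rewrite mulmxBr dhE -scalemxAr dgE scale_scalar_mx -raddfB scalar_neq0.
  apply: contraNneq nz => E; have -> : a * kg * dh + b * kf * eh = a * kg * (dh - l * eh * b).
    by rewrite /l; field; rewrite a0 kg0.
  by rewrite E mulr0.
have us : s \in unitmx := word_ball_unit genX sB.
pose q := k *m s; pose h' := invmx s *m h.
have qf : q *m f = 0 by rewrite /q -mulmxA.
have qh' : q *m h' = 0 by rewrite /q /h' mulmxA mulmxK.
have q0 : q != 0.
  apply: contraNneq kMh => E; have -> : k = q *m invmx s by rewrite /q mulmxK.
  by rewrite E !mul0mx.
exists q; split=> //.
- by move=> y; apply: contraNneq dsh => ->; rewrite -/h' -scalemxAl qh' scaler0.
- move=> y; apply: contraNneq q0 => E; move/eqP: qh'; rewrite E -scalemxAl scaler_eq0 (negPf dsh) orbF.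
  by move=> /eqP ->; rewrite scale0r.
have rootq x : tv f (x *: q) \in
    wb (root_cost + root_cost + 2 * (3 * (n * n + root_cost + n * n) + 2 * root_cost)).
  pose y := x / (d *m h') 0 0.
  have dh'0 : (d *m h') 0 0 != 0 by rewrite -mx11_eq0.
  have td : tv f d \in wb root_cost by rewrite -[d]scale1r.
  have yqh' : (y *: q) *m h' = 0 by rewrite -scalemxAl qh' scaler0.
  have yqf : (y *: q) *m f = 0 by rewrite -scalemxAl qf scaler0.
  have tq : tv h' (y *: q) \in wb (3 * (n * n + root_cost + n * n) + 2 * root_cost).
    have := word_ball_conj genX (word_ball_inv genX sB) (roothk y).
    rewrite tv_conj ?unitmx_inv // invmxK -scalemxAl; apply: word_ball_mono.
    by move: root_cost => R; clear; lia.
  have := tv_commutator df yqh' yqf.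
  rewrite mul_mx11_row scalerA mulrC divfK // => <-.
  have := word_ball_mul (word_ball_mul (word_ball_mul td tq) (word_ball_inv genX td)) (word_ball_inv genX tq).
  by apply: word_ball_mono; move: root_cost => R; clear; lia.
move=> x y; rewrite -tvDr // word_ball_mul //.
Qed.

End RootGroups.

(** * All transvections at f, and at a basis of translates *)

Section Fan.
Variables (F : finFieldType) (n : nat) (X : {set 'M[F]_n}).
Hypotheses (n3 : (2 < n)%N) (genX : generates_SL X).
Variables (f : 'cV[F]_n) (d : 'rV[F]_n).
Hypotheses (f0 : f != 0) (d0 : d != 0) (df : d *m f = 0) (tX : tv f d \in X).
Variable K : nat.
Hypothesis sl2K : forall a b : F, a != 0 -> b != 0 -> forall x, upper x \in ball a b K.
Local Notation wb := (word_ball X).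
Implicit Types (w : 'M[F]_n) (g h : 'cV[F]_n) (e q : 'rV[F]_n) (k l : nat).

(* [(f^T w^-T) (d^T q - q^T d) w^-1] lies in the pencil of the conjugate root
   and vanishes on [f]; the commutator with a root at [f] moves it to [f]. *)
Definition fan_cost := (4 * pencil_cost n K + 4 * (n * (n * n)))%N.

Lemma exists_fan v : (forall a, v != a *: f) -> exists e : 'rV[F]_n,
  [/\ e *m f = 0, e *m v != 0 & forall x, tv f (x *: e) \in wb fan_cost].
Proof.
move=> vf; have [q [qf dq qd pencil]] := exists_pencil n3 genX f0 d0 df tX sl2K.
pose A := d^T *m q - q^T *m d.
have [w [r [dw rdq rwf Hw]]] := exists_pair_conj dq qd df qf f0 vf.
(* A tensor of a vector with a bilinear form, in dimension n^3: w acts on f and on the alternating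
   form [A] together. The conditions r (w f) != 0 and e v != 0 become one linear condition on it. *)
pose act w : 'M[F]_(n * n) := lin_mx (mulmxr (invmx w) \o mulmx (invmx w)^T).
pose rho w : 'End('M[F]_(n, n * n)) := linfun (mulmxr (act w) \o mulmx w).
pose u := f *m mxvec A.
have rhoE w' : rho w' u = (w' *m f) *m mxvec ((invmx w')^T *m A *m invmx w').
  by rewrite lfunE /= /u mulmxA -[LHS]mulmxA mul_vec_lin.
pose phi : 'Hom('M[F]_(n, n * n), 'M[F]_(1, 1 * 1)) :=
  linfun (mulmxr (lin_mx (mulmxr v \o mulmx f^T)) \o mulmx r).
have phiE w' : (phi (rho w' u) != 0) = (r *m (w' *m f) != 0) &&
    (f^T *m ((invmx w')^T *m A *m invmx w') *m v != 0).
  rewrite rhoE lfunE /=; move: (w' *m f) => p.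
  rewrite [r *m (p *m _)]mulmxA -[_ *m mxvec _ *m _]mulmxA mul_vec_lin /=.
  rewrite mul_mx11_row scaler_eq0 negb_or -mx11_eq0; congr (_ && _).
  by rewrite -[X in mxvec _ != X](linear0 mxvec) (can_eq mxvecK).
have [||||w' w'B] := @short_word _ _ _ genX _ _ rho u phi w.
- by rewrite rhoE /u invmx1 trmx1 !mul1mx mulmx1.
- move=> a h /det1_unit ua /det1_unit uh; rewrite !rhoE lfunE /= mulmxA -[_ *m mxvec _ *m _]mulmxA mul_vec_lin /=.
  by rewrite invmxM // trmx_mul !mulmxA.
- exact: dw.
- by rewrite phiE rwf.
rewrite dim_matrix in w'B; rewrite phiE => /andP[rw'f Hw'].
pose e := f^T *m ((invmx w')^T *m A *m invmx w').
pose x0 := (d *m invmx w' *m f) 0 0; pose y0 := - (q *m invmx w' *m f) 0 0.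
have eE : e = (y0 *: d + x0 *: q) *m invmx w'.
  rewrite /e !mulmxA -trmx_mul /A mulmxBr mulmxBl !mulmxA -!trmx_mul !mulmxA.
  rewrite [(d *m _ *m f)]mx11_scalar [(q *m _ *m f)]mx11_scalar !tr_scalar_mx !mul_scalar_mx.
  by rewrite mulmxDl scaleNr addrC mulNmx.
have ef : e *m f = 0.
  rewrite eE -mulmxA mulmxDl -!scalemxAl !mulmxA.
  rewrite [d *m _ *m f]mx11_scalar [q *m _ *m f]mx11_scalar !scale_scalar_mx -/x0.
  by rewrite -raddfD /= [y0 * _]mulrC -mulrDr /y0 addNr mulr0 raddf0.
exists e; split=> // x.
pose N := (n * (n * n))%N; pose C := pencil_cost n K.
have pf a b : (a *: d + b *: q) *m f = 0 by rewrite mulmxDl -!scalemxAl df qf !scaler0 addr0.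
have tr' : tv f r \in wb C.
  by case: rdq => ->; [have := pencil 1 0|have := pencil 0 1];
     rewrite scale1r scale0r ?addr0 ?add0r.
have rf : r *m f = 0 by case: rdq => ->.
pose c := (r *m (w' *m f)) 0 0; have c0 : c != 0 by rewrite -mx11_eq0.
have eg : (x / c *: e) *m (w' *m f) = 0.
  by rewrite -scalemxAl eE (conj_vanish genX w'B (pf _ _)) scaler0.
have xef : (x / c *: e) *m f = 0 by rewrite -scalemxAl ef scaler0.
have te : tv (w' *m f) (x / c *: e) \in wb (N + C + N).
  have := conj_ball genX (pf _ _) w'B (pencil (x / c * y0) (x / c * x0)).
  have -> : (x / c * y0) *: d + (x / c * x0) *: q = x / c *: (y0 *: d + x0 *: q).
    by rewrite scalerDr !scalerA.
  by rewrite -scalemxAl -eE.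
have := tv_commutator rf eg xef.
rewrite mul_mx11_row -/c scalerA [c * _]mulrC divfK // => <-.
have := word_ball_mul (word_ball_mul (word_ball_mul tr' te) (word_ball_inv genX tr')) (word_ball_inv genX te).
by apply: word_ball_mono; rewrite /fan_cost -/N -/C; clear; lia.
Qed.

(** The functionals q whose whole line gives short transvections span the annihilator of f: a vector
    v killed by all of them but not by e would not be a multiple of f, contrary to [exists_fan].
    Hence e is a sum of at most n multiples of such q. *)
Lemma all_transvections_at e : e *m f = 0 -> tv f e \in wb (n * fan_cost).
Proof.
move=> ef; pose S := [set q : 'rV[F]_n | (q *m f == 0) && [forall x : F, tv f (x *: q) \in wb fan_cost]].
pose A : 'M[F]_(#|S|, n) := \matrix_(i < #|S|) enum_val i.
have eA : (e <= A)%MS.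
  apply: contraT => /separate_row[v Av ev].
  have [a|q [qf qv tq]] := @exists_fan v.
    by apply: contraNneq ev => ->; rewrite -scalemxAr ef scaler0.
  have qS : q \in S by rewrite inE qf eqxx; apply/forallP.
  case/eqP: qv; have <- : row (enum_rank_in qS q) A = q by rewrite rowK enum_rankK_in.
  by rewrite -row_mul Av linear0.
have sumS (s : seq 'rV[F]_n) : all (fun q => q \in S) s ->
    (\sum_(q <- s) q) *m f = 0 /\ tv f (\sum_(q <- s) q) \in wb (size s * fan_cost).
  elim: s => [|q s IH] /=; first by rewrite big_nil mul0mx tv0r inE.
  case/andP; rewrite inE => /andP[/eqP qf /forallP/(_ 1) tq] /IH[sf ts].
  rewrite scale1r in tq; rewrite big_cons mulmxDl qf sf addr0; split=> //.
  by rewrite -tvDr // mulSn word_ball_mul.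
have [D eD] : exists D, e = D *m rowsub (maxrankfun A) A.
  by apply/submxP; rewrite eq_maxrowsub.
have -> : e = \sum_(q <- [seq D 0 i *: row i (rowsub (maxrankfun A) A) | i <- enum 'I_(\rank A)]) q.
  by rewrite big_map big_enum eD mulmx_sum_row.
have [|_] := sumS [seq D 0 i *: row i (rowsub (maxrankfun A) A) | i <- enum 'I_(\rank A)].
  apply/allP => q /mapP[i _ ->]; have := enum_valP (maxrankfun A i).
  rewrite row_rowsub rowK; move: (enum_val _) => q'; rewrite !inE => /andP[/eqP q'f /forallP tq'].
  by rewrite -scalemxAl q'f scaler0 eqxx; apply/forallP => x; rewrite scalerA.
apply: word_ball_mono; rewrite size_map -cardE card_ord leq_mul2r.
by apply/orP; right; apply: rank_leq_col.
Qed.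

Definition column_cost := (n + n * fan_cost + n)%N.

(** The translates of f by words of length at most n span the space, by [short_word] in the natural
    representation; n of them form [P], and conjugation carries the transvections at f along. *)
Lemma exists_orbit_basis : exists P : 'M[F]_n, P \in unitmx /\
  forall i (e : 'rV[F]_n), e *m col i P = 0 -> tv (col i P) e \in wb column_cost.
Proof.
pose W := word_ball X n.
pose A : 'M[F]_(#|W|, n) := \matrix_(i < #|W|) (enum_val i *m f)^T.
have Afull : row_full A.
  rewrite -sub1mx; apply: contraT => /row_subPn[i /separate_row[v Av iv]].
  pose q := v^T; have q0 : q != 0.
    by apply: contraNneq iv => /(congr1 trmx); rewrite trmxK trmx0 => ->; rewrite mulmx0.
  have [g [dg gf]] : exists g : 'M[F]_n, \det g = 1 /\ q *m (g *m f) != 0.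
    have [qf|qf] := eqVneq (q *m f) 0; last by exists 1%:M; rewrite det1 mul1mx.
    by have [g [dg gf _]] := exists_opposite_conj q0 f0 qf; exists g.
  pose rho w : 'End('cV[F]_n) := linfun (mulmx w).
  have rhoE w u : rho w u = w *m u by rewrite lfunE.
  pose phi : 'Hom('cV[F]_n, 'M[F]_1) := linfun (mulmx q).
  have [||||w wB] := @short_word _ _ _ genX _ _ rho f phi g.
  - by rewrite rhoE mul1mx.
  - by move=> a h _ _; rewrite !rhoE mulmxA.
  - exact: dg.
  - by rewrite lfunE /= rhoE.
  rewrite lfunE /= rhoE => /eqP[]; rewrite dim_matrix mulr1 in wB.
  have <- : (row (enum_rank_in wB w) A) ^T = w *m f by rewrite rowK enum_rankK_in // trmxK.
  by apply: trmx_inj; rewrite trmx_mul trmxK trmxK -row_mul Av !linear0.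
exists (rowsub (fullrankfun Afull) A)^T; split.
  by rewrite unitmx_tr fullrowsub_unit.
move=> i e; rewrite -tr_row row_rowsub rowK trmxK; set w := enum_val _ => ewf.
have wB : w \in wb n by apply: enum_valP.
have -> : e = (e *m w) *m invmx w by rewrite mulmxK ?(word_ball_unit genX wB).
apply: (conj_ball genX) => //; first by rewrite -mulmxA.
by apply: all_transvections_at; rewrite -mulmxA.
Qed.

End Fan.

(** * Gaussian elimination in the new basis *)

Section Elimination.
Variables (F : finFieldType) (n : nat) (X : {set 'M[F]_n}).
Variables (P : 'M[F]_n) (Q : nat).
Hypothesis uP : P \in unitmx.
Hypothesis rootP : forall i (e : 'rV[F]_n),
  e *m col i P = 0 -> tv (col i P) e \in word_ball X Q.
Local Notation wb := (word_ball X).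
Local Notation cvec i := (delta_mx i 0 : 'cV[F]_n).
Local Notation rvec i := (delta_mx 0 i : 'rV[F]_n).
Implicit Types (A : 'M[F]_n) (i j k l : 'I_n) (x : F).

Definition in_basis A := P *m A *m invmx P.

Lemma in_basisM A B : in_basis (A *m B) = in_basis A *m in_basis B.
Proof. by rewrite /in_basis !mulmxA mulmxKV. Qed.

Lemma rvec_cvec i j : rvec i *m cvec j = (i == j)%:R%:M.
Proof.
rewrite mul_delta_mx_cond; case: (i == j); apply/matrixP => a b; rewrite !ord1.
  by rewrite mulr1n !mxE.
by rewrite mulr0n !mxE mul0rn.
Qed.

Lemma elementary_ball i j x : i != j -> in_basis (tv (cvec i) (x *: rvec j)) \in wb Q.
Proof.
move=> ij; rewrite /in_basis tv_conj // -colE; apply: rootP.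
rewrite colE mulmxA mulmxKV // -scalemxAl rvec_cvec.
by rewrite (eq_sym j) (negPf ij) raddf0 scaler0.
Qed.

Lemma clear_column_ball k (c : 'cV[F]_n) : c k 0 = 0 -> in_basis (tv c (rvec k)) \in wb (n * Q).
Proof.
move=> ck; pose c' (s : seq 'I_n) := \sum_(i <- s) c i 0 *: cvec i.
have H (s : seq 'I_n) : rvec k *m c' s = 0 /\ in_basis (tv (c' s) (rvec k)) \in wb (size s * Q).
  elim: s => [|i s [kc IH]].
    by rewrite /c' big_nil mulmx0 tv0l /in_basis mulmx1 mulmxV // inE.
  have kci : rvec k *m (c i 0 *: cvec i) = 0.
    rewrite -scalemxAr rvec_cvec; case: eqP => [<-|_]; first by rewrite ck scale0r.
    by rewrite raddf0 scaler0.
  rewrite /c' big_cons -/(c' s) mulmxDr kci kc addr0; split=> //.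
  rewrite -tvDl // in_basisM /= mulSn word_ball_mul // tvZ.
  have [ik|ik] := eqVneq i k; last exact: elementary_ball.
  by rewrite ik ck scale0r tv0r /in_basis mulmx1 mulmxV // word_ball1.
have cE : c = c' (enum 'I_n).
  rewrite /c' big_enum [LHS]matrix_sum_delta; apply: eq_bigr => i _.
  by rewrite big_ord1.
by have [_] := H (enum 'I_n); rewrite size_enum_ord -cE.
Qed.

Lemma row_op_entry i j x A a b :
  (tv (cvec i) (x *: rvec j) *m A) a b = A a b + (a == i)%:R * (x * A j b).
Proof.
rewrite tv_mull -scalemxAl -rowE !mxE big_ord1 !mxE eqxx andbT.
by [].
Qed.

Definition standard_upto (m : nat) A := forall a b : 'I_n, (b < m)%N -> A a b = (a == b)%:R.

(** In the last column no lower row is available for normalising the pivot; here the determinant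
    shows that it is already 1. *)
Lemma det_last_column k A : k.+1 = n -> standard_upto k A -> \det A = A k k.
Proof.
move=> kn stdA; have E : A = tv (col k A - cvec k) (rvec k).
  apply/matrixP => a b; rewrite !mxE big_ord1 !mxE eqxx /=.
  have [->|bk] := eqVneq b k; first by rewrite andbT mulr1 addrC subrK.
  rewrite mulr0 addr0 stdA // ltn_neqAle bk -ltnS kn ltn_ord //.
rewrite {1}E det_tv mulmxBr rvec_cvec eqxx -rowE !mxE.
by rewrite addrCA subrr addr0.
Qed.

(** If column k vanished from the diagonal down, it would be a combination of the preceding standard
    columns, and [v] would be a nonzero kernel vector. *)
Lemma diagonal_neq0 k A : A \in unitmx -> standard_upto k A ->
  (forall a : 'I_n, (k < a)%N -> A a k = 0) -> A k k != 0.
Proof.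
move=> uA stdA below; apply: contraT; rewrite negbK => /eqP Akk.
pose v : 'cV[F]_n := cvec k - \col_l (if (l < k)%N then A l k else 0).
have Av : A *m v = 0.
  apply/matrixP => a b; rewrite ord1 mulmxBr -colE !mxE.
  rewrite (bigID (fun l : 'I_n => (l < k)%N)) /=.
  have -> : \sum_(l < n | ~~ (l < k)%N) A a l * (\col_l0 (if (l0 < k)%N then A l0 k else 0)) l 0 = 0.
    by apply: big1 => l lk; rewrite mxE (negPf lk) mulr0.
  rewrite addr0.
  have -> : \sum_(l < n | (l < k)%N) A a l * (\col_l0 (if (l0 < k)%N then A l0 k else 0)) l 0
      = \sum_(l < n | (l < k)%N) (if l == a then A l k else 0).
    apply: eq_bigr => l lk; rewrite mxE lk stdA // eq_sym.
    by case: eqP => _; rewrite ?mul1r ?mul0r.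
  rewrite -big_mkcondr /=; have [ak|ka] := ltnP a k.
    by rewrite (big_pred1 a) ?subrr // => l /=; case: (eqVneq l a) => [->|_]; rewrite ?ak ?andbF.
  rewrite big1 ?subr0; last by move=> l /andP[lk /eqP la]; move: lk; rewrite la ltnNge ka.
  by move: ka; rewrite leq_eqVlt => /orP[/eqP/val_inj <- //|/below].
have : v k 0 = 0 by rewrite -[v](mulKmx uA) Av mulmx0 mxE.
by rewrite !mxE !eqxx ltnn subr0 => /eqP; rewrite oner_eq0.
Qed.

(** One row operation to create a nonzero entry below the pivot, one to make the pivot 1, and n to
    clear the column. *)
Definition column_step := (Q + (Q + n * Q))%N.

Lemma eliminate m A : (m <= n)%N -> \det A = 1 -> standard_upto (n - m) A ->
  in_basis A \in wb (m * column_step).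
Proof.
elim: m A => [|m IH] A mn dA stdA.
  have -> : A = 1%:M by apply/matrixP => a b; rewrite stdA ?subn0 // mxE.
  by rewrite /in_basis mulmx1 mulmxV // word_ball1.
have kn : (n - m.+1 < n)%N by lia.
pose k := Ordinal kn; have kS : (n - m = k.+1)%N by rewrite /=; lia.
have stdS (B : 'M[F]_n) : standard_upto k B -> (forall a, B a k = (a == k)%:R) -> standard_upto (n - m) B.
  move=> sB Bk a b; rewrite kS ltnS leq_eqVlt => /orP[/eqP/val_inj ->|/sB] //.
have pivot1 (B : 'M[F]_n) : \det B = 1 -> standard_upto k B -> B k k = 1 ->
    in_basis B \in wb (n * Q + m * column_step).
  move=> dB sB Bkk; pose c := col k B - cvec k.
  have ck : c k 0 = 0 by rewrite !mxE Bkk !eqxx subrr.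
  have kc : rvec k *m c = 0.
    by rewrite -rowE; apply/matrixP => a b; rewrite !ord1 mxE ck mxE.
  have kc' : rvec k *m (- c) = 0 by rewrite mulmxN kc oppr0.
  pose B' := tv (- c) (rvec k) *m B.
  have B'E a b : B' a b = B a b - c a 0 * B k b.
    by rewrite /B' tv_mull -rowE mulNmx !mxE big_ord1 !mxE.
  have -> : B = tv c (rvec k) *m B' by rewrite mulmxA tvDl // subrr tv0l mul1mx.
  rewrite in_basisM word_ball_mul ?clear_column_ball //; apply: IH; first exact: ltnW.
    by rewrite det_mulmx dB mulr1 det_tv1.
  apply: stdS => [a b bk|a].
    by rewrite B'E (sB k b bk) [k == b]eq_sym -val_eqE /= (ltn_eqF bk) mulr0 subr0 sB.
  by rewrite B'E Bkk mulr1 !mxE opprB addrC subrK eqxx andbT.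
have row_op (i j : 'I_n) x (B : 'M[F]_n) M : i != j -> (k <= j)%N -> \det B = 1 -> standard_upto k B ->
    (forall B', \det B' = 1 -> standard_upto k B' -> (forall a b, B' a b = B a b + (a == i)%:R * (x * B j b)) ->
       in_basis B' \in wb M) -> in_basis B \in wb (Q + M).
  move=> ij kj dB sB HB'; pose B' := tv (cvec i) (x *: rvec j) *m B.
  have rc : rvec j *m cvec i = 0 by rewrite rvec_cvec eq_sym (negPf ij) raddf0.
  have rcx y : (y *: rvec j) *m cvec i = 0 by rewrite -scalemxAl rc scaler0.
  have -> : B = tv (cvec i) ((- x) *: rvec j) *m B'.
    by rewrite mulmxA tvDr // -scalerDl addNr scale0r tv0r mul1mx.
  rewrite in_basisM word_ball_mul ?elementary_ball //; apply: HB'.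
  - by rewrite det_mulmx dB mulr1 det_tv1.
  - move=> a b bk; rewrite row_op_entry (sB j b bk) -[j == b]val_eqE /=.
    by rewrite gtn_eqF ?(leq_trans bk) // !mulr0 addr0 sB.
  - exact: row_op_entry.
(* Adding (1 - B k k) / B i k times row i to row k makes the pivot 1. *)
have pivot2 (B : 'M[F]_n) i : \det B = 1 -> standard_upto k B -> (k < i)%N -> B i k != 0 ->
    in_basis B \in wb (Q + (n * Q + m * column_step)).
  move=> dB sB ki Bik; apply: (@row_op k i ((1 - B k k) / B i k)) => //.
  - by rewrite -val_eqE /= ltn_eqF.
  - exact: ltnW.
  move=> B' dB' sB' B'E; apply: pivot1 => //.
  by rewrite B'E eqxx mul1r divfK // addrC subrK.
rewrite mulSn /column_step -!addnA -/column_step.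
have stdk : standard_upto k A by [].
have uA : A \in unitmx by apply: det1_unit.
case: (pickP (fun i : 'I_n => (k < i)%N && (A i k != 0))) => [i /andP[ki Aik]|none].
  by apply: word_ball_mono (pivot2 _ _ dA stdk ki Aik); rewrite leq_addl.
have below (a : 'I_n) : (k < a)%N -> A a k = 0.
  by move=> ka; have := none a; rewrite ka => /negbFE/eqP.
have Akk := diagonal_neq0 uA stdk below.
have [k1n|] := ltnP k.+1 n; last first.
  move=> nk; have kn' : k.+1 = n by apply/eqP; rewrite eqn_leq nk andbT.
  apply: word_ball_mono (pivot1 _ dA stdk _); first by lia.
  by rewrite -(det_last_column kn' stdk).
(* All entries below the pivot vanish, so adding row k to row k + 1 copies the nonzero pivot below
   the diagonal. *)
apply: (@row_op (Ordinal k1n) k 1) => //; first by rewrite -val_eqE /= gtn_eqF.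
move=> B' dB' sB' B'E; apply: (@pivot2 _ (Ordinal k1n)) => //.
by rewrite B'E eqxx mul1r mul1r below // add0r.
Qed.

Lemma SL_ball g : \det g = 1 -> g \in wb (n * column_step).
Proof.
move=> dg; have -> : g = in_basis (invmx P *m g *m P).
  by rewrite /in_basis !mulmxA mulmxV // mul1mx mulmxK.
apply: eliminate => //; last by move=> a b; rewrite subnn.
by rewrite !det_mulmx det_inv mulrC mulrA dg mulr1 divff // -unitfE -unitmxE.
Qed.

End Elimination.

Local Close Scope ring_scope.
From Stdlib Require Import Reals Lra.

(** * Explicit bounds *)

Lemma INR_muln (m n : nat) : INR (muln m n) = (INR m * INR n)%R.
Proof. exact: mult_INR. Qed.

Lemma INR_expn (m n : nat) : INR (expn m n) = (INR m ^ n)%R.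
Proof. by elim: n => [|n IH] //; rewrite expnS INR_muln IH. Qed.

Lemma ln_le_compat (x y : R) : (0 < x)%R -> (x <= y)%R -> (ln x <= ln y)%R.
Proof.
move=> x0 [xy|<-]; last exact: Rle_refl.
by apply: Rlt_le; apply: ln_increasing.
Qed.

Lemma ln_pow_nat (x : R) (n : nat) : (0 < x)%R -> ln (x ^ n) = (INR n * ln x)%R.
Proof.
move=> x0; elim: n => [|n IH]; first by rewrite /= ln_1 Rmult_0_l.
rewrite /= ln_mult //; last exact: pow_lt.
by rewrite IH; case: n {IH} => [|n]; rewrite /=; lra.
Qed.

Lemma ln_le_pow2 (m n : nat) : (0 < m)%N -> (m <= expn 2 n)%N -> (ln (INR m) <= INR n)%R.
Proof.
move=> /leP/lt_INR/= m0 /leP/le_INR; rewrite INR_expn => mn.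
apply: Rle_trans (_ : (ln (INR 2 ^ n) <= _)%R).
  by apply: ln_le_compat.
rewrite ln_pow_nat; last by rewrite /=; lra.
have n0 := pos_INR n.
suff : (ln (INR 2) <= 1)%R by nra.
have -> : (1 = ln (exp 1))%R by rewrite ln_exp.
by apply: ln_le_compat; rewrite /=; have := exp_ineq1 1; lra.
Qed.

Lemma geometric_hit (L : R) : (1 <= L)%R ->
  exists k : nat, (L <= (26 / 25) ^ k)%R /\ ((26 / 25) ^ k <= 26 / 25 * L)%R.
Proof.
move=> L1; have [n nL] : exists n : nat, (L <= (26 / 25) ^ n)%R.
  have [|N HN] := Pow_x_infinity (26 / 25) _ L; first by rewrite Rabs_right; lra.
  exists N; have := HN N (le_n _); rewrite Rabs_right; first lra.
  by apply: Rle_ge; apply: pow_le; lra.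
elim: n nL => [|n IH] nL; first by exists 0%N; rewrite /= in nL *; lra.
have [/IH //|nL'] : (L <= (26 / 25) ^ n \/ (26 / 25) ^ n < L)%R by lra.
by exists n.+1; split=> //=; lra.
Qed.

(** Let x, y, l be the logarithms of N, N', q. The first alternative gives 3x <= 13 + 2y. The second
    gives 3x + 6l <= 21 + 5y with 2x <= 2 + 5l, so y >= 1.08x - 4.68, which is at least 1.04x once x
    >= 117. *)
Lemma log_growth (q N N' K1 K2 : nat) : (0 < N)%N -> (0 < N')%N -> (0 < q)%N ->
  (0 < K1 <= expn 2 13)%N -> (0 < K2 <= expn 2 21)%N ->
  (expn N 3 <= K1 * expn N' 2)%N \/ (expn N 3 * expn q 6 <= K2 * expn N' 5)%N ->
  (expn N 2 <= 4 * expn q 5)%N ->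
  (120 <= ln (INR N))%R -> (26 / 25 * ln (INR N) <= ln (INR N'))%R.
Proof.
move=> N0 N'0 q0 /andP[p1 K1le] /andP[p2 K2le] H Hq HN.
have c1 := ln_le_pow2 p1 K1le; have c2 := ln_le_pow2 p2 K2le.
have p4 : (0 < 4)%N by [].
have c3 : (ln (INR 4) <= INR 2)%R by apply: ln_le_pow2.
have pos (m : nat) : (0 < m)%N -> (0 < INR m)%R by move=> /leP/lt_INR.
have ln_nat_le (x y : nat) : (0 < x)%N -> (x <= y)%N -> (ln (INR x) <= ln (INR y))%R.
  by move=> /pos x0 /leP/le_INR xy; apply: ln_le_compat.
have lnX (m n : nat) : (0 < m)%N -> ln (INR (expn m n)) = (INR n * ln (INR m))%R.
  by move=> /pos m0; rewrite INR_expn ln_pow_nat.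
have lnM (m n : nat) : (0 < m)%N -> (0 < n)%N ->
    ln (INR (muln m n)) = (ln (INR m) + ln (INR n))%R.
  by move=> /pos m0 /pos n0; rewrite INR_muln ln_mult.
have X0 (m n : nat) : (0 < m)%N -> (0 < expn m n)%N by move=> m0; rewrite expn_gt0 m0.
have natR (m : nat) : INR m = IZR (Z.of_nat m) by rewrite INR_IZR_INZ.
have i2 : INR 2 = 2%R by rewrite natR.
have i3 : INR 3 = 3%R by rewrite natR.
have i5 : INR 5 = 5%R by rewrite natR.
have i6 : INR 6 = 6%R by rewrite natR.
have i13 : INR 13 = 13%R by rewrite natR.
have i21 : INR 21 = 21%R by rewrite natR.
move: (ln_nat_le _ _ (X0 _ 2%N N0) Hq); rewrite (lnM _ _ p4 (X0 _ 5%N q0)) !lnX //.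
rewrite i13 i21 i2 i5 in c1 c2 c3 * => {}Hq.
case: H => H.
  move: (ln_nat_le _ _ (X0 _ 3%N N0) H); rewrite (lnM _ _ p1 (X0 _ 2%N N'0)) !lnX //.
  by rewrite i2 i3; lra.
have l0 : (0 < expn N 3 * expn q 6)%N by rewrite muln_gt0 !X0.
move: (ln_nat_le _ _ l0 H).
rewrite (lnM _ _ (X0 _ 3%N N0) (X0 _ 6%N q0)) (lnM _ _ p2 (X0 _ 5%N N'0)) !lnX //.
by rewrite i3 i5 i6; lra.
Qed.

(** Each growth step multiplies the radius by 14 and the logarithm of the ball size by 26/25 at
    least. This comparison turns the radius into a power of the logarithm, with exponent 72. *)
Lemma fourteen_le : (14 <= (26 / 25) ^ 72)%R.
Proof.
have h : (2 <= (26 / 25) ^ 18)%R by lra.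
have -> : ((26 / 25) ^ 72 = ((26 / 25) ^ 18) ^ 4)%R by rewrite -pow_mult.
apply: Rle_trans (_ : (2 ^ 4 <= _)%R); first by rewrite /=; lra.
by apply: pow_incr; lra.
Qed.

(** The radii 14^i r0 are tried for i <= k, where (26/25)^k is about ln p. If all failed, the
    logarithm of the last ball size would be at least 120 ln p, while failure bounds its double by
    ln 4 + 5 ln p. *)
Lemma large_ball_radius (p r0 : nat) (a : nat -> nat) :
  (0 < p)%N -> (1 <= ln (INR p))%R -> (120 <= ln (INR (a r0)))%R -> (4 <= r0)%N ->
  (forall r, (0 < a r)%N) ->
  (forall r, (4 <= r)%N ->
    (expn (a r) 3 <= 810 * 8 * expn (a (14 * r)) 2)%N \/
    (expn (a r) 3 * expn p 6 <= 810 * 27 * 64 * expn (a (14 * r)) 5)%N) ->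
  exists2 r, (4 * expn p 5 < expn (a r) 2)%N &
    (INR r <= INR r0 * (26 / 25 * ln (INR p)) ^ 72)%R.
Proof.
move=> p0 L1 ar0 r04 a0 growth; set L := ln (INR p) in L1 *.
have [k [kL kU]] := geometric_hit L1.
pose r i := (expn 14 i * r0)%N.
have r4 i : (4 <= r i)%N by rewrite (leq_trans r04) // leq_pmull // expn_gt0.
have rS i : r i.+1 = (14 * r i)%N by rewrite /r expnS mulnA.
have rk i : (i <= k)%N -> (INR (r i) <= INR r0 * (26 / 25 * L) ^ 72)%R.
  move=> ik; rewrite /r INR_muln; rewrite INR_expn Rmult_comm.
  apply: Rmult_le_compat_l; first exact: pos_INR.
  have i14 : INR 14 = 14%R by rewrite INR_IZR_INZ.
  rewrite i14; apply: Rle_trans (_ : (14 ^ k <= _)%R).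
    by apply: Rle_pow; [lra|apply/leP].
  apply: Rle_trans (_ : (((26 / 25) ^ 72) ^ k <= _)%R).
    by apply: pow_incr; have := fourteen_le; lra.
  rewrite -pow_mult Nat.mul_comm pow_mult; apply: pow_incr; split=> //.
  by apply: pow_le; lra.
have [i /andP[ik big]|small] := pickP (fun i : 'I_k.+1 => (i <= k)%N && (4 * expn p 5 < expn (a (r i)) 2)%N).
  by exists (r i) => //; apply: rk.
exfalso; have le i : (i <= k)%N -> (expn (a (r i)) 2 <= 4 * expn p 5)%N.
  by move=> ik; have := small (Ordinal (n := k.+1) ik); rewrite /= ik /= => /negbT; rewrite -leqNgt.
have grow i : (i <= k)%N -> (120 * (26 / 25) ^ i <= ln (INR (a (r i))))%R.
  elim: i => [|i IH] ik; first by rewrite /r expn0 mul1n /=; lra.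
  have {}IH := IH (ltnW ik).
  have one : (1 <= (26 / 25) ^ i)%R by apply: pow_R1_Rle; lra.
  have c1 : (0 < 810 * 8 <= expn 2 13)%N by [].
  have c2 : (0 < 810 * 27 * 64 <= expn 2 21)%N.
    by rewrite !muln_gt0 /= -[21%N]/(7 + 7 + 7)%N !expnD -[expn 2 7]/(128%N); lia.
  have := log_growth (a0 _) (a0 _) p0 c1 c2 (growth (r i) (r4 i)) (le _ (ltnW ik)).
  rewrite -rS /=; move: (ln (INR (a (r i)))) (ln _) IH => x y IH; nra.
have G := grow k (leqnn k).
have A0 : (0 < INR (a (r k)))%R by apply: lt_0_INR; apply/leP.
have P0 : (0 < INR p)%R by apply: lt_0_INR; apply/leP.
have := le k (leqnn k) => /leP/le_INR; rewrite INR_muln !INR_expn => H.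
have {}H := ln_le_compat (pow_lt _ 2 A0) H.
have i4 : INR 4 = 4%R by rewrite INR_IZR_INZ.
have i2 : INR 2 = 2%R by rewrite INR_IZR_INZ.
have i5 : INR 5 = 5%R by rewrite INR_IZR_INZ.
move: H; rewrite ln_mult ?i4; [|lra|exact: pow_lt].
rewrite !ln_pow_nat // i2 i5 -/L.
have ln4 : (ln 4 <= 4)%R.
  by apply: Rlt_le; apply: exp_lt_inv; rewrite exp_ln; [have := exp_ineq1 4; lra|lra].
move: (ln (INR (a (r k)))) G => x G; lra.
Qed.

(** The first summand of [C] serves the primes above r0. For p <= r0 the radius p is enough, and the
    second summand absorbs it because ln p >= ln 2. *)
Lemma sl2_diameter : exists2 C : R, (0 < C)%R &
  forall p : nat, prime p -> forall b c : 'F_p, b \is a GRing.unit -> c \is a GRing.unit ->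
  exists k, [/\ (0 < k)%N, (INR k <= C * (ln (INR p)) ^ 72)%R &
                forall x : 'F_p, upper x \in ball b c k].
Proof.
(* For p > r0 the ball of radius r0 has more than r0 elements, so its logarithm passes the threshold
   120 of [log_growth]. *)
have [r0 Hr0] := INR_unbounded (exp 120).
have r0pos : (0 < INR r0)%R by have := exp_pos 120; lra.
have r04 : (4 <= r0)%N.
  apply/leP/INR_le; have := exp_ineq1 120; rewrite INR_IZR_INZ /=; lra.
pose l2 := ln 2.
have l20 : (0 < l2)%R by rewrite /l2 -ln_1; apply: ln_increasing; lra.
pose C := (24 * INR r0 * (26 / 25) ^ 72 + INR r0 / l2 ^ 72)%R.
have A : (0 < 24 * INR r0 * (26 / 25) ^ 72)%R.
  by apply: Rmult_lt_0_compat; [lra|apply: pow_lt; lra].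
have B : (0 < INR r0 / l2 ^ 72)%R by apply: Rdiv_lt_0_compat => //; apply: pow_lt.
exists C; first by rewrite /C; lra.
move=> p pP b c; rewrite !unitfE => b0 c0.
have p1 := prime_gt1 pP.
have p2R : (2 <= INR p)%R by rewrite -[2%R]/(INR 2); apply: le_INR; apply/leP.
have l2L : (l2 <= ln (INR p))%R by apply: ln_le_compat; lra.
have L0 : (0 < ln (INR p))%R by lra.
have LP : (0 < ln (INR p) ^ 72)%R by apply: pow_lt.
have [pr|pr] := leqP p r0.
  exists p; split; [exact: ltnW|  |exact: small_field_up].
  have prR : (INR p <= INR r0)%R by apply: le_INR; apply/leP.
  have : (1 <= ln (INR p) ^ 72 / l2 ^ 72)%R.
    apply: (Rmult_le_reg_r (l2 ^ 72)); first exact: pow_lt.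
    rewrite Rmult_1_l /Rdiv Rmult_assoc Rinv_l ?Rmult_1_r.
      by apply: pow_incr; lra.
    by apply: Rgt_not_eq; apply: pow_lt.
  rewrite /C Rmult_plus_distr_r.
  have -> : (INR r0 / l2 ^ 72 * ln (INR p) ^ 72 = INR r0 * (ln (INR p) ^ 72 / l2 ^ 72))%R.
    by rewrite /Rdiv Rmult_assoc [(/ _ * ln _ ^ _)%R]Rmult_comm.
  move: (_ / _)%R => y y1.
  have : (0 < 24 * INR r0 * (26 / 25) ^ 72 * ln (INR p) ^ 72)%R by apply: Rmult_lt_0_compat.
  by nra.
have p4 : (4 < p)%N by apply: leq_ltn_trans r04 pr.
have [||||r rbig rle] := @large_ball_radius p r0 (fun r => #|ball b c r|) _ _ _ r04 _ (fun r => Fp_ball_growth pP b0 c0 p4).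
- exact: ltnW.
- rewrite -[1%R]ln_exp; apply: ln_le_compat; first exact: exp_pos.
  have : (INR r0 < INR p)%R by apply: lt_INR; apply/leP.
  by have := exp_increasing 1 120; lra.
- rewrite -[120%R]ln_exp; apply: ln_le_compat; first exact: exp_pos.
  have : (INR r0 < INR #|ball b c r0|)%R by apply: lt_INR; apply/leP; apply: ball_size.
  by lra.
- by move=> r; apply/card_gt0P; exists one2; apply: one_ball.
have r0' : (0 < r)%N.
  case: r rbig {rle} => // + ; rewrite ltnNge => /negP[].
  rewrite /= cards1 muln_gt0 expn_gt0; lia.
exists (24 * r)%N; split; [by rewrite muln_gt0 | | exact: Fp_large_ball].
rewrite INR_muln; have -> : INR 24 = 24%R by rewrite INR_IZR_INZ.
move: rle; rewrite Rpow_mult_distr => rle.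
rewrite /C Rmult_plus_distr_r.
have : (0 < INR r0 / l2 ^ 72 * ln (INR p) ^ 72)%R by apply: Rmult_lt_0_compat.
by lra.
Qed.

Lemma cost_bound n K : (0 < n)%N -> (0 < K)%N ->
  (n * column_step n (column_cost n K) <= 630 * K * expn n 14)%N.
Proof.
move=> n0 K0; pose N := (K * n)%N.
have root_le : (root_cost n K <= 3 * (N * n))%N.
  by rewrite /root_cost /N; have := leq_mul n0 n0; nia.
have pencil_le : (pencil_cost n K <= 51 * (N * n))%N.
  have : (n * n <= N * n)%N by rewrite leq_mul2r /N leq_pmull ?orbT.
  by rewrite /pencil_cost; move: (root_cost n K) root_le => R; lia.
have fan_le : (fan_cost n K <= 208 * (N * n * n))%N.
  have : (n * (n * n) <= N * n * n)%N by rewrite mulnA !leq_mul2r /N leq_pmull ?orbT.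
  have : (N * n <= N * n * n)%N by rewrite leq_pmulr.
  by rewrite /fan_cost; lia.
have column_le : (column_cost n K <= 210 * (N * n * n * n))%N.
  have : (n <= N * n * n * n)%N by rewrite leq_pmull // !muln_gt0 n0 K0.
  have : (n * fan_cost n K <= n * (208 * (N * n * n)))%N by rewrite leq_mul2l fan_le orbT.
  by rewrite /column_cost; lia.
have step_le : (column_step n (column_cost n K) <= 3 * (n * column_cost n K))%N.
  have : (column_cost n K <= n * column_cost n K)%N by rewrite leq_pmull.
  by rewrite /column_step; lia.
(* The costs multiply to 630 K n^6, with 630 = 3 * 210; then n^6 <= n^14. *)
apply: leq_trans (_ : 630 * K * expn n 6 <= _)%N; last first.
  by rewrite leq_mul2l leq_pexp2l ?orbT.
apply: leq_trans (_ : n * (3 * (n * (210 * (N * n * n * n)))) <= _)%N.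
  rewrite leq_mul2l; apply/orP; right; apply: leq_trans step_le _.
  by rewrite !leq_mul2l column_le !orbT.
by rewrite /N !expnS expn0; apply: eq_leq; lia.
Qed.

(** The radii in [sl2_diameter] vary with the two parameters; the floor of their common real bound
    is one integer that serves for all. *)
Lemma nat_floor (x : R) : (0 <= x)%R ->
  exists K : nat, (INR K <= x)%R /\ forall k : nat, (INR k <= x)%R -> (k <= K)%N.
Proof.
move=> x0; have [N] := INR_unbounded x; elim: N => [|N IH] xN; first by rewrite /= in xN; lra.
have [Nx|/IH //] : (INR N <= x \/ x < INR N)%R by lra.
exists N; split=> // k kx; rewrite -ltnS; apply/leP; apply: INR_lt; lra.
Qed.

(* diam Cay(SL_n(F_p), X) <= C (log p)^c n^14, expressed as: some k with
   k <= C (log p)^c n^14 bounds the word length of every element. *)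
Theorem theorem1p3 :
  exists c C : R, (0 < c)%R /\ (0 < C)%R /\
  forall (p n : nat), prime p -> (3 <= n)%N ->
  forall X : {set 'M['F_p]_n},
    generates_SL X ->
    (exists t, t \in X /\ is_transvection t) ->
    exists k : nat, words_cover X k /\
      (INR k <= C * Rpower (ln (INR p)) c * INR n ^ 14)%R.
Proof.
have [C C0 HC] := sl2_diameter.
exists (INR 72), (INR 630 * C)%R.
have r630 : (0 < INR 630)%R by apply: lt_0_INR; apply/leP.
split; first by apply: lt_0_INR; apply/leP.
split; first exact: Rmult_lt_0_compat.
move=> p n pP n3 X genX [t [tX [d [f [d0 f0 df tE]]]]].
pose logp := ln (INR p).
have logp0 : (0 < logp)%R.
  rewrite /logp -ln_1; apply: ln_increasing; first by lra.
  by rewrite -[1%R]/(INR 1); apply: lt_INR; apply/leP; apply: prime_gt1.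
have [K [Kle Kmax]] := nat_floor (Rlt_le _ _ (Rmult_lt_0_compat _ _ C0 (pow_lt _ 72 logp0))).
have Kup (a b : 'F_p) : a \is a GRing.unit -> b \is a GRing.unit ->
    (0 < K)%N /\ forall x, upper x \in ball a b K.
  move=> ua ub; have [k [k0 kle kup]] := HC p pP a b ua ub.
  have kK := Kmax _ kle; split; first exact: leq_trans kK.
  by move=> x; apply: ball_mono kK (kup x).
(* Positivity of [K] comes from the instance with both parameters equal to 1. *)
have [K0 _] := Kup _ _ (unitr1 _) (unitr1 _).
have sl2K (a b : 'F_p) : a != GRing.zero -> b != GRing.zero -> forall x, upper x \in ball a b K.
  by rewrite -!unitfE => ua ub; case: (Kup _ _ ua ub).
rewrite tE -/(tv f d) in tX.
have [P [uP rootP]] := exists_orbit_basis n3 genX f0 d0 df tX sl2K.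
exists (n * column_step n (column_cost n K))%N; split.
  move=> g; rewrite inE => /eqP dg; exact: word_ballP (SL_ball uP rootP dg).
have /leP/le_INR := cost_bound (ltnW (ltnW n3)) K0.
rewrite (INR_muln (630 * K)) (INR_muln 630) INR_expn Rpower_pow // => H.
apply: Rle_trans H _; apply: Rmult_le_compat_r; first by apply: pow_le; apply: pos_INR.
by rewrite Rmult_assoc; apply: Rmult_le_compat_l; [lra | exact: Kle].
Qed.
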